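(* Let $\ell\geqslant1$ be an integer. Let $(m_1,\dots,m_n)$ be a partition of $2\ell$ such that $m_j\leqslant\ell$ for every $j\in\{1,\dots,n\}$. Let $p_1,\dots,p_n$ be distinct points of the Riemann sphere $\overline{\mathbb{C}}=\mathbb{C}\cup\{\infty\}$. Then there exists a conformal generalized Ricci metric of type $(-2\ell,0,0)$ on $\overline{\mathbb{C}}$ such that its curvature $K$ satisfies $K\geqslant0$, the zeroes of the function $\sqrt K$ are $p_1,\dots,p_n$ and their respective orders are $m_1,\dots,m_n$.
   Context: Smooth means of class $C^\infty$. A partition of a positive integer $N$ is a tuple $(m_1,\dots,m_n)$ with $n\geqslant1$, all $m_j$ positive integers, and $m_1+\dots+m_n=N$. A metric on a Riemann surface is conformal if it is compatible with the complex structure. For $(a,b,c)\in\mathbb{R}^3$, a smooth Riemannian metric $ds^2$ on a surface, with Gaussian curvature $K$, is a generalized Ricci metric of type $(a,b,c)$ if $(c-K)\Delta K+\|\nabla K\|^2+(aK+b)(K-c)^2=0$, where $\Delta=\operatorname{div}\nabla$. A zero $p$ of $\sqrt{|K-c|}$ has order $m$ if near $p$ one can write $\sqrt{|K-c|}=|rh|$ with $r$ a smooth $\mathbb{C}^*$-valued function and $h$ a holomorphic function with a zero of order $m$ at $p$. *)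

(* Defs.v *)
From Stdlib Require Import Reals.
From Coquelicot Require Import Coquelicot.
From Stdlib Require Import List.
Open Scope R_scope.

(* The complex line is identified with the plane with coordinates
   x = real part (axis [X]) and y = imaginary part (axis [Y]). *)
Inductive axis := X | Y.

Definition coord (v : C) (i : axis) : R :=
  match i with X => fst v | Y => snd v end.

Definition sum_axis (f : axis -> R) : R := f X + f Y.

Definition slice (i : axis) (f : C -> R) (p : C) : R -> R :=
  match i with
  | X => fun t => f (t, snd p)
  | Y => fun t => f (fst p, t)
  end.

Definition partial (i : axis) (f : C -> R) (p : C) : R :=
  Derive (slice i f p) (coord p i).

(* [class_Ck n U f] is only meant for open [U]. *)
Fixpoint class_Ck (n : nat) (U : C -> Prop) (f : C -> R) : Prop :=
  (forall p, U p -> continuous f p) /\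
  match n with
  | O => True
  | S n' => forall i : axis,
      (forall p, U p -> ex_derive (slice i f p) (coord p i)) /\
      class_Ck n' U (partial i f)
  end.

Definition smooth_on (U : C -> Prop) (f : C -> R) : Prop :=
  forall n, class_Ck n U f.

Definition holomorphic_on (U : C -> Prop) (h : C -> C) : Prop :=
  forall z : C, U z -> ex_derive (K := C_AbsRing) (V := C_NormedModule) h z.

(* [g i j p] is the coefficient g_ij at the point p of a chart with image the
   whole plane. *)
Definition tensor := axis -> axis -> C -> R.

Definition inner (g : tensor) (p u v : C) : R :=
  sum_axis (fun i => sum_axis (fun j => g i j p * coord u i * coord v j)).

Record riemannian (g : tensor) : Prop := {
  riemannian_smooth : forall i j, smooth_on (fun _ => True) (g i j);
  riemannian_sym : forall i j p, g i j p = g j i p;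
  riemannian_pos : forall p v : C, v <> 0%C -> 0 < inner g p v v
}.

Definition gdet (g : tensor) (p : C) : R :=
  g X X p * g Y Y p - g X Y p * g Y X p.

Definition ginv (g : tensor) (i j : axis) (p : C) : R :=
  match i, j with
  | X, X => g Y Y p / gdet g p
  | X, Y => - g X Y p / gdet g p
  | Y, X => - g Y X p / gdet g p
  | Y, Y => g X X p / gdet g p
  end.

(* Gamma^k_ij of the Levi-Civita connection. *)
Definition christoffel (g : tensor) (k i j : axis) (p : C) : R :=
  sum_axis (fun l => ginv g k l p *
    (partial i (g j l) p + partial j (g i l) p - partial l (g i j) p) / 2).

(* Coefficient on d_l of R(d_i, d_j) d_k
   = nabla_i nabla_j d_k - nabla_j nabla_i d_k. *)
Definition riemann (g : tensor) (l i j k : axis) (p : C) : R :=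
  partial i (christoffel g l j k) p - partial j (christoffel g l i k) p
  + sum_axis (fun m => christoffel g m j k p * christoffel g l i m p
                     - christoffel g m i k p * christoffel g l j m p).

(* <R(d_x, d_y) d_y, d_x> / (|d_x|^2 |d_y|^2 - <d_x, d_y>^2) *)
Definition gauss_curvature (g : tensor) (p : C) : R :=
  sum_axis (fun l => riemann g l X Y Y p * g l X p) / gdet g p.

Definition grad (g : tensor) (f : C -> R) (i : axis) (p : C) : R :=
  sum_axis (fun j => ginv g i j p * partial j f p).

Definition divergence (g : tensor) (V : axis -> C -> R) (p : C) : R :=
  sum_axis (fun i => partial i (fun q => sqrt (gdet g q) * V i q) p)
  / sqrt (gdet g p).

Definition laplacian (g : tensor) (f : C -> R) (p : C) : R :=
  divergence g (grad g f) p.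

Definition grad_norm2 (g : tensor) (f : C -> R) (p : C) : R :=
  let v := (grad g f X p, grad g f Y p) in inner g p v v.

Definition ricci_equation (a b c : R) (g : tensor) (p : C) : Prop :=
  let K := gauss_curvature g in
  (c - K p) * laplacian g K p + grad_norm2 g K p
  + (a * K p + b) * (K p - c) ^ 2 = 0.

(* [None] is the point at infinity. *)
Definition sphere := option C.

(* The coordinate z, and the coordinate w = 1/z around infinity. *)
Inductive chart := Zchart | Wchart.

Definition chart_point (k : chart) (z : C) : sphere :=
  match k with
  | Zchart => Some z
  | Wchart => if Ceq_dec z 0%C then None else Some (/ z)%C
  end.

Definition chart_at (q : sphere) : chart :=
  match q with Some _ => Zchart | None => Wchart end.

Definition coord_at (q : sphere) : C :=
  match q with Some z => z | None => 0%C end.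

(* The compatibility condition says that the two local expressions agree under
   z = 1/w, whose derivative is -1/w^2. *)
Record sphere_metric := {
  metric_in :> chart -> tensor;
  metric_riemannian : forall k, riemannian (metric_in k);
  metric_compat : forall w u v : C, w <> 0%C ->
    inner (metric_in Wchart) w u v =
    inner (metric_in Zchart) (/ w)%C (- / (w * w) * u)%C (- / (w * w) * v)%C
}.

(* Multiplication by i on tangent spaces is the complex structure in either
   chart. *)
Definition conformal (g : sphere_metric) : Prop :=
  forall (k : chart) (p u v : C),
    inner (g k) p (Ci * u)%C (Ci * v)%C = inner (g k) p u v.

Definition generalized_ricci (a b c : R) (g : sphere_metric) : Prop :=
  forall (k : chart) (p : C), ricci_equation a b c (g k) p.

Definition curvature (g : sphere_metric) (q : sphere) : R :=
  gauss_curvature (g (chart_at q)) (coord_at q).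

Definition holomorphic_zero (U : C -> Prop) (h : C -> C) (z0 : C) (m : nat)
  : Prop :=
  exists k : C -> C, holomorphic_on U k /\ k z0 <> 0%C /\
    forall z, U z -> h z = ((z - z0) ^ m * k z)%C.

(* [q] is a zero of order [m] of the real function [f]: near [q], f = |r h|
   with r smooth and nowhere zero, h holomorphic with a zero of order m. *)
Definition zero_order (f : sphere -> R) (q : sphere) (m : nat) : Prop :=
  exists (U : C -> Prop) (r h : C -> C),
    open U /\ U (coord_at q) /\
    smooth_on U (fun z => fst (r z)) /\ smooth_on U (fun z => snd (r z)) /\
    (forall z, U z -> r z <> 0%C) /\
    holomorphic_on U h /\ holomorphic_zero U h (coord_at q) m /\
    (forall z, U z -> f (chart_point (chart_at q) z) = Cmod (r z * h z)%C).

Definition is_partition (N : nat) (m : list nat) : Prop :=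
  m <> nil /\ Forall (fun k => (1 <= k)%nat) m /\ list_sum m = N.

(* Main.v *)
Require Import Defs.
From Stdlib Require Import Reals.
From Coquelicot Require Import Coquelicot.
From Stdlib Require Import List Lra Lia FunctionalExtensionality Classical_Prop.
From HB Require structures.
From mathcomp Require all_boot all_order all_algebra all_fingroup.
From mathcomp Require complex Rstruct ring zify.

(** Let d = l + 1, and let P and Q be polynomials of degree at most d, without
    common zero on the sphere when they are seen as sections of O(d). The metric
    E |dz|^2 with E = (|P|^2 + |Q|^2)^(-2/d) is then smooth on the whole sphere.
    By Lagrange's identity its curvature is

      K = (4/d) |W|^2 (|P|^2 + |Q|^2)^(2/d - 2),   W = P Q' - P' Q,

    so that the square root of K vanishes like W. Outside the zeros of W the
    logarithm of |W|^2 is harmonic, hence the Laplacian of ln K is -2 l K, and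
    this is the required equation ([gauss_curvature_pencil], [pencil_ricci]).
    It remains to find P and Q, that is, a rational function of degree l + 1
    with ramification m_j at p_j ([exists_pencil]).

    Give each point p_j as many slots s as its multiplicity says, 2 l slots in
    all, and for a 2 x 2 matrix A let the tensor product of the matrices p_s - A
    act on the 2l-th tensor power of the plane. Its mean over the unitary
    conjugates A of diag(z, w) preserves the invariants of SL2; let H(z, w) be
    z - w times this mean, restricted to the invariants ([hecke]). A matrix
    coefficient of the product H(a, b) H(c, d) is a mean over pairs (A, A') of a
    quantity that depends only on the conjugacy class of the quadratic matrix
    polynomial (x - A)(x - A'). This class is determined by the roots a, b, c, d
    of the determinant and by kappa = tr(A A'), and kappa is uniformly
    distributed between a d + b c and a c + b d. Therefore the coefficient is the
    integral of one function of kappa, symmetric in b, c and d, between these two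
    numbers ([pairing_hecke2]), and the additivity of integrals is the Pluecker
    relation

      H(a, b) H(c, d) - H(a, c) H(b, d) + H(a, d) H(b, c) = 0.

    This relation and H(b, a) = - H(a, b) imply that all these operators commute
    ([hecke_comm]), so they have a common eigenvector psi among the invariants
    that are symmetric in the slots of each point. Such invariants exist because
    m_j <= l: the slots s and s + l carry different points, and the product of the
    determinants of these pairs of slots has a nonzero symmetrization
    ([exists_invariant]). The eigenvalue of H(z, w) satisfies the Pluecker
    relation as well, so it is P(w) Q(z) - P(z) Q(w) for some polynomials P and Q,
    and its quotient by z - w is, at w = z, the product of the p_s - z. Hence the
    Wronskian of P and Q has the prescribed zeros. At a common zero x of P and Q
    the eigenvalue would be zero for all w; but its expansion at w = x starts
    with a sum of squares of coordinates of psi, and this sum is nonzero because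
    the equations of an invariant propagate its vanishing to all coordinates
    ([eigenpoly_neq0]). Finally a Moebius map reduces divisors that contain the
    point at infinity to finite ones ([exists_sphere_pencil]). *)

Module RationalPencils.
Import structures all_boot all_order all_algebra all_fingroup ring zify.
Set Implicit Arguments. Unset Strict Implicit. Unset Printing Implicit Defensive.
Import Order.TTheory GRing.Theory Num.Theory.
Local Open Scope ring_scope.

(** * Tensor powers of the plane, indexed by subsets *)

Section Kronecker.
Variables (R : comNzRingType) (n : nat).
Implicit Types (A B : bool -> bool -> R) (X Y : 'I_n -> bool -> bool -> R).
Implicit Types (f g h : {set 'I_n}) (phi psi : {set 'I_n} -> R).

Definition mat2 (a b c d : R) : bool -> bool -> R :=
  fun i j => if i then if j then d else c else if j then b else a.

Definition mul2 A B : bool -> bool -> R :=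
  fun i j => A i false * B false j + A i true * B true j.

(** The n-th tensor power of the plane has a basis indexed by subsets: slot s
    carries the second basis vector when s is in the subset, the first one
    otherwise. These are the entries of the tensor product of the X s. *)
Definition kron X f g : R := \prod_s X s (s \in f) (s \in g).

Definition kron_app X psi f : R := \sum_(g : {set _}) kron X f g * psi g.

Definition pairing phi psi : R := \sum_(f : {set _}) phi f * psi f.

Lemma eq_kron X Y : (forall s i j, X s i j = Y s i j) -> kron X =2 kron Y.
Proof. by move=> e f g; apply: eq_bigr. Qed.

Lemma eq_kron_app X Y psi : (forall s i j, X s i j = Y s i j) ->
  kron_app X psi =1 kron_app Y psi.
Proof. by move=> e f; apply: eq_bigr => g _; rewrite (eq_kron e). Qed.

Lemma sum_prod_sets (F : 'I_n -> bool -> R) :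
  \sum_(g : {set _}) \prod_s F s (s \in g) = \prod_s (F s false + F s true).
Proof.
transitivity (\prod_s \sum_(b : bool) F s b); last first.
  by apply: eq_bigr => s _; rewrite big_bool addrC.
rewrite bigA_distr_bigA /=.
rewrite (reindex (fun g : {set 'I_n} => [ffun s => s \in g])) /=.
  by apply: eq_bigr => g _; apply: eq_bigr => s _; rewrite ffunE.
exists (fun u : {ffun 'I_n -> bool} => [set s | u s]) => u _.
  by apply/setP => s; rewrite inE ffunE.
by apply/ffunP => s; rewrite ffunE inE.
Qed.

Lemma kronM X Y f h :
  \sum_(g : {set _}) kron X f g * kron Y g h = kron (fun s => mul2 (X s) (Y s)) f h.
Proof.
rewrite -[RHS](sum_prod_sets
  (fun s b => X s (s \in f) b * Y s b (s \in h))).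
by apply: eq_bigr => g _; rewrite -big_split.
Qed.

Lemma kron_appM X Y psi f :
  kron_app X (kron_app Y psi) f = kron_app (fun s => mul2 (X s) (Y s)) psi f.
Proof.
rewrite /kron_app; under eq_bigr => g _ do rewrite mulr_sumr.
rewrite exchange_big /=; apply: eq_bigr => h _.
rewrite -kronM mulr_suml; apply: eq_bigr => g _; by rewrite mulrA.
Qed.

Definition shear (x : R) := mat2 1 0 x 1.

Lemma kron_shear x f g :
  kron (fun=> shear x) f g = if g \subset f then x ^+ #|f :\: g| else 0.
Proof.
case: ifPn => [gf|/subsetPn[s sg sf]]; last first.
  by rewrite /kron (bigD1 s) //= (negPf sf) sg /shear /= mul0r.
rewrite /kron (bigID (mem (f :\: g))) /= [X in _ * X]big1 ?mulr1; last first.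
  move=> s; rewrite inE negb_and negbK => /orP[sg|sf].
    by rewrite sg (subsetP gf s sg).
  by rewrite (negPf sf); case: (boolP (s \in g)) => // /(subsetP gf); rewrite (negPf sf).
rewrite (eq_bigr (fun=> x)) ?prodr_const //.
by move=> s; rewrite inE => /andP[/negPf -> ->].
Qed.

Definition supported (l : nat) psi := forall f, #|f| != l -> psi f = 0.

Definition shear_fixed (l : nat) psi :=
  forall f, (l < #|f|)%N -> \sum_(g : {set _} | g \subset f) psi g = 0.

Definition coshear_fixed (l : nat) psi :=
  forall f, (#|f| < l)%N -> \sum_(g : {set _} | f \subset g) psi g = 0.

(** All the subsets of f that contribute have the same size, so that the shear
    multiplies them by the same power of x; what remains is the sum that occurs
    in [shear_fixed]. *)
Lemma kron_app_shear l psi x : supported l psi -> shear_fixed l psi ->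
  kron_app (fun=> shear x) psi =1 psi.
Proof.
move=> sup fix_psi f; rewrite /kron_app.
under eq_bigr => g _ do rewrite kron_shear.
transitivity (\sum_(g : {set _} | g \subset f) x ^+ (#|f| - l) * psi g).
  rewrite [RHS]big_mkcond /=; apply: eq_bigr => g _.
  case: ifP => gf; last by rewrite mul0r.
  have [<-|/sup ->] := eqVneq #|g| l; last by rewrite !mulr0.
  by rewrite cardsD (setIidPr gf).
rewrite -mulr_sumr; case: (ltngtP #|f| l) => lf.
- rewrite sup ?ltn_eqF // big1 ?mulr0 // => g gf; apply: sup.
  by rewrite ltn_eqF // (leq_ltn_trans (subset_leq_card gf)).
- by rewrite fix_psi // mulr0 sup // gtn_eqF.
rewrite lf subnn mul1r (bigD1 f) //= big1 ?addr0 // => g /andP[gf ng].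
apply: sup; rewrite ltn_eqF // -lf proper_card // properEneq ng //.
Qed.

Lemma kron_coapp_shear l phi x g : supported l phi -> coshear_fixed l phi ->
  \sum_(f : {set _}) phi f * kron (fun=> shear x) f g = phi g.
Proof.
move=> sup fix_phi.
under eq_bigr => f _ do rewrite kron_shear.
transitivity (\sum_(f : {set _} | g \subset f) x ^+ (l - #|g|) * phi f).
  rewrite [RHS]big_mkcond /=; apply: eq_bigr => f _.
  case: ifP => gf; last by rewrite mulr0.
  have [<-|/sup ->] := eqVneq #|f| l; last by rewrite mulr0 mul0r.
  by rewrite cardsD (setIidPr gf) mulrC.
rewrite -mulr_sumr; case: (ltngtP #|g| l) => lg.
- by rewrite fix_phi // mulr0 sup // ltn_eqF.
- rewrite sup ?gtn_eqF // big1 ?mulr0 // => f gf; apply: sup.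
  by rewrite gtn_eqF // (leq_trans lg) // subset_leq_card.
rewrite lg subnn mul1r (bigD1 g) //= big1 ?addr0 // => f /andP[gf ng].
apply: sup; rewrite gtn_eqF // -lg proper_card // properEneq eq_sym ng //.
Qed.

(** The two outer shears are absorbed by the two vectors that they fix, so a
    matrix coefficient only depends on the simultaneous conjugacy class of the
    matrices in the slots. *)
Lemma pairing_conj_shear l phi psi X t :
  supported l phi -> coshear_fixed l phi ->
  supported l psi -> shear_fixed l psi ->
  pairing phi (kron_app (fun s => mul2 (shear (- t)) (mul2 (X s) (shear t))) psi)
  = pairing phi (kron_app X psi).
Proof.
move=> s1 f1 s2 f2.
have step f : kron_app (fun s => mul2 (shear (- t)) (mul2 (X s) (shear t))) psi f
  = \sum_(g : {set _}) kron (fun=> shear (- t)) f g * kron_app X psi g.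
  rewrite -kron_appM; apply: eq_bigr => g _; congr (_ * _).
  rewrite -kron_appM; apply: eq_bigr => h _.
  by rewrite (kron_app_shear _ s2 f2).
rewrite /pairing; under eq_bigr => f _ do rewrite step mulr_sumr.
rewrite exchange_big /=; apply: eq_bigr => g _.
rewrite -(kron_coapp_shear (- t) g s1 f1) mulr_suml.
by apply: eq_bigr => f _; rewrite mulrA.
Qed.

Lemma kron_upper X f g :
  (forall s, X s true false = 0) -> (#|g| < #|f|)%N -> kron X f g = 0.
Proof.
move=> A0 gf; have /subsetPn[s sf sg] : ~~ (f \subset g).
  by apply: contraL gf => /subset_leq_card; rewrite leqNgt.
by rewrite /kron (bigD1 s) //= sf (negPf sg) A0 mul0r.
Qed.
End Kronecker.

Section Morphism.
Variables (R S : comNzRingType) (h : {rmorphism R -> S}) (n : nat).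
Implicit Types (X : 'I_n -> bool -> bool -> R) (phi psi : {set 'I_n} -> R).

Lemma rmorph_kron X f g : h (kron X f g) = kron (fun s i j => h (X s i j)) f g.
Proof. by rewrite /kron rmorph_prod. Qed.

Lemma rmorph_kron_app X psi f :
  h (kron_app X psi f) = kron_app (fun s i j => h (X s i j)) (fun g => h (psi g)) f.
Proof.
rewrite /kron_app rmorph_sum; apply: eq_bigr => g _.
by rewrite rmorphM rmorph_kron.
Qed.

Lemma rmorph_pairing phi psi :
  h (pairing phi psi) = pairing (fun f => h (phi f)) (fun f => h (psi f)).
Proof. by rewrite /pairing rmorph_sum; apply: eq_bigr => f _; rewrite rmorphM. Qed.
End Morphism.

(** Between subsets of the same size an upper triangular matrix acts through its
    diagonal: a lower entry is needed for each upper one. *)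
Lemma kron_upper_eq (R : comNzRingType) n (X : 'I_n -> bool -> bool -> R)
    (f g : {set 'I_n}) : (forall s, X s true false = 0) -> #|f| = #|g| ->
  kron X f g = if f == g then \prod_s X s (s \in f) (s \in f) else 0.
Proof.
move=> X0 fg; case: eqP => [<- //|/eqP nfg].
have /subsetPn[s sf sg] : ~~ (f \subset g).
  by apply: contra nfg => fsg; rewrite eqEcard fsg fg leqnn.
by rewrite /kron (bigD1 s) //= sf (negPf sg) X0 mul0r.
Qed.

Lemma kron_diag (R : comNzRingType) n (X : 'I_n -> bool -> bool -> R)
    (f g : {set 'I_n}) :
  (forall s, X s true false = 0) -> (forall s, X s false true = 0) ->
  kron X f g = if f == g then \prod_s X s (s \in f) (s \in f) else 0.
Proof.
move=> X0 X1; case: eqP => [<- //|/eqP nfg].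
have [s] : exists s, (s \in f) != (s \in g).
  apply/existsP; apply: contraR nfg; rewrite negb_exists => /forallP H.
  by apply/eqP/setP => s; apply/eqP; have := H s; rewrite negbK.
rewrite /kron (bigD1 s) //=.
by case: (s \in f); case: (s \in g) => //; rewrite ?X0 ?X1 mul0r.
Qed.

(** * Raising and lowering operators *)

Section Ladder.
Variables (R : comNzRingType) (n : nat).
Implicit Types (f g h F : {set 'I_n}) (psi : {set 'I_n} -> R).

Definition raise psi F : R := \sum_(s in F) psi (F :\ s).
Definition lower psi f : R := \sum_(s | s \notin f) psi (s |: f).

Lemma big_setU1_setD1 s (A : {set 'I_n} -> {set 'I_n} -> R) :
  \sum_(f : {set 'I_n} | s \notin f) A f (s |: f) =
  \sum_(F : {set 'I_n} | s \in F) A (F :\ s) F.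
Proof.
rewrite (reindex_onto (fun F => F :\ s) (fun f => s |: f)) /=; last first.
  by move=> f sf; rewrite setU1K.
apply: eq_big => F; last by move=> /andP[_ /eqP->].
rewrite !inE eqxx /=.
by apply/eqP/idP => [<-|/setD1K //]; rewrite !inE eqxx.
Qed.

Lemma pairing_lower phi psi : pairing (lower phi) psi = pairing phi (raise psi).
Proof.
rewrite /pairing /lower /raise.
under eq_bigr do rewrite mulr_suml; under [RHS]eq_bigr do rewrite mulr_sumr.
rewrite (exchange_big_dep predT) //= [RHS](exchange_big_dep predT) //=.
by apply: eq_bigr => s _; rewrite (big_setU1_setD1 s (fun f F => phi F * psi f)).
Qed.

(** The commutator of raising and lowering is the weight operator of sl2: the
    moves that remove one element and add another one occur on both sides. *)
Lemma raise_lower psi g :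
  raise (lower psi) g + psi g *+ (n - #|g|) = lower (raise psi) g + psi g *+ #|g|.
Proof.
have -> : raise (lower psi) g = psi g *+ #|g| +
    \sum_(s in g) \sum_(t | t \notin g) psi (t |: (g :\ s)).
  rewrite -sumr_const -big_split /=; apply: eq_bigr => s sg.
  rewrite /lower (bigD1 s) ?inE ?eqxx //= setD1K //; congr (_ + _).
  apply: eq_bigl => t; rewrite !inE; case: eqVneq => [->|] //=; last by rewrite andbT.
  by rewrite sg.
have -> : lower (raise psi) g = psi g *+ (n - #|g|) +
    \sum_(s | s \notin g) \sum_(t in g) psi (s |: (g :\ t)).
  have -> : (n - #|g| = #|~: g|)%N by rewrite [RHS]cardsCs card_ord setCK.
  rewrite -sumr_const.
  transitivity (\sum_(s in ~: g) (psi g + \sum_(t in g) psi (s |: (g :\ t)))).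
    apply: eq_big => [s|s sg]; first by rewrite inE.
    rewrite /raise (bigD1 s) ?inE ?eqxx //= setU1K //; congr (_ + _).
    apply: eq_big => t.
      rewrite !inE; case: eqVneq => [->|] //=; last by rewrite andbT.
      by rewrite (negPf sg).
    rewrite !inE => /andP[tg ts]; congr psi; apply/setP => u; rewrite !inE.
    case: (eqVneq u s) => [->|] //=; rewrite ?andbT //.
    by rewrite eq_sym ts.
  by rewrite big_split; congr (_ + _); apply: eq_bigl => s; rewrite inE.
rewrite [X in _ = _ + X + _]exchange_big /=; ring.
Qed.

(** Double counting of the pairs (g, s) with s in F but not in g, through the
    set h obtained by adding s to g. *)
Lemma sum_subsets_raise psi F :
  \sum_(g : {set 'I_n} | g \subset F) psi g *+ #|F :\: g| =
  \sum_(h : {set 'I_n} | h \subset F) raise psi h.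
Proof.
transitivity (\sum_(g : {set 'I_n} | g \subset F) \sum_(s in F :\: g) psi g).
  by apply: eq_bigr => g _; rewrite sumr_const.
rewrite (exchange_big_dep (mem F)) /=; last by move=> g s _; rewrite inE => /andP[].
rewrite [RHS](exchange_big_dep (mem F)) /=; last by move=> h s /subsetP; apply.
apply: eq_bigr => s sF.
transitivity (\sum_(g : {set 'I_n} | s \notin g)
                if s |: g \subset F then psi g else 0).
  rewrite -big_mkcondr; apply: eq_bigl => g.
  by rewrite inE sF subUset sub1set sF /= andbT andbC.
rewrite (big_setU1_setD1 s (fun g h => if h \subset F then psi g else 0)).
by rewrite -big_mkcondr; apply: eq_bigl => h; rewrite andbC.
Qed.

End Ladder.

Section Invariants.
Variables (K : numClosedFieldType) (n : nat).
Implicit Types (f g h F : {set 'I_n}) (psi : {set 'I_n} -> K).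

Lemma raise_shear_fixed l psi :
  supported l psi -> (forall F, raise psi F = 0) -> shear_fixed l psi.
Proof.
move=> sup ra F lF; have := sum_subsets_raise psi F.
rewrite [RHS]big1 // => H.
have : (\sum_(g : {set 'I_n} | g \subset F) psi g) *+ (#|F| - l) = 0.
  rewrite -sumrMnl -[RHS]H; apply: eq_bigr => g gF.
  have [<-|/sup ->] := eqVneq #|g| l; last by rewrite !mul0rn.
  by rewrite cardsD (setIidPr gF).
by move/eqP; rewrite mulrn_eq0 subn_eq0 leqNgt lF /= => /eqP.
Qed.

Lemma pairing_conj_eq0 psi : pairing psi (fun f => (psi f)^*) = 0 -> forall f, psi f = 0.
Proof.
move=> /eqP; rewrite psumr_eq0 => [/allP H f|f _]; last exact: mul_conjC_ge0.
have := H f (mem_index_enum f); rewrite /= mul_conjC_eq0 => /eqP //.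
Qed.

(** Lowering is the adjoint of raising, so the squared norm of the lowered
    vector pairs psi with the conjugate of raise (lower psi). This differs from
    lower (raise psi), which is zero, by a multiple of the weight, which is zero
    in the middle size. *)
Lemma raise_lower_eq0 l psi : n = (l + l)%N ->
  supported l psi -> (forall F, raise psi F = 0) -> forall f, lower psi f = 0.
Proof.
move=> nl sup ra; apply: pairing_conj_eq0.
rewrite pairing_lower /pairing big1 // => F _.
have [lF|/sup ->] := eqVneq #|F| l; last by rewrite mul0r.
have conj_sum (I : finType) (P : pred I) (E : I -> K) :
    (\sum_(i | P i) E i)^* = \sum_(i | P i) (E i)^* by rewrite rmorph_sum.
have -> : raise (fun f => (lower psi f)^*) F = (raise (lower psi) F)^*.
  by rewrite /raise conj_sum.
have nll : (n - l = l)%N by lia.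
have := raise_lower psi F; rewrite lF nll => /addIr ->.
by rewrite /lower big1 ?conjC0 ?mulr0 // => s _; rewrite ra.
Qed.

(** Complementation exchanges raising and lowering, and preserves the middle
    size. *)
Lemma lower_coshear_fixed l psi : n = (l + l)%N ->
  supported l psi -> (forall f, lower psi f = 0) -> coshear_fixed l psi.
Proof.
move=> nl sup lo f lf.
have sup' : supported l (fun g => psi (~: g)).
  move=> g gl; apply: sup; apply: contra gl => /eqP e; apply/eqP.
  by have := cardsC g; rewrite card_ord; lia.
have ra' F : raise (fun g => psi (~: g)) F = 0.
  rewrite -(lo (~: F)); apply: eq_big => [s|s sF]; first by rewrite inE negbK.
  by congr psi; apply/setP => u; rewrite !inE negb_and negbK.
rewrite -[RHS](raise_shear_fixed sup' ra' (f := ~: f)); last first.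
  by have := cardsC f; rewrite card_ord; lia.
rewrite [LHS](reindex_inj (@setC_inj 'I_n)) /=; apply: eq_bigl => g.
by rewrite -setCS setCK.
Qed.

End Invariants.

(** * Integrals of polynomials *)

Section Integral.
Variable K : numFieldType.
Implicit Types (q Q : {poly K}) (a b c d : K).

Definition primitive q : {poly K} := \poly_(i < (size q).+1) (q`_i.-1 / i%:R).

Definition integral q c d : K := (primitive q).[d] - (primitive q).[c].

Lemma deriv_primitive q : (primitive q)^`() = q.
Proof.
apply/polyP => i; rewrite coef_deriv coef_poly ltnS /=.
case: ltnP => iq; last by rewrite mul0rn nth_default.
by rewrite -mulrnAr -[X in _ * X]mulr_natr mulVf ?mulr1 // pnatr_eq0.
Qed.

Lemma integralE Q q c d : Q^`() = q -> integral q c d = Q.[d] - Q.[c].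
Proof.
move=> Qq; rewrite /integral; set D := primitive q - Q.
have D0 : D^`() = 0 by rewrite derivB deriv_primitive Qq subrr.
have Dc : D = (D`_0)%:P.
  apply/polyP => -[|i]; rewrite coefC //=.
  have := congr1 (fun r : {poly K} => r`_i) D0.
  by rewrite coef_deriv coef0 => /eqP; rewrite mulrn_eq0 /= => /eqP.
have -> : primitive q = (D`_0)%:P + Q by rewrite -Dc subrK.
by rewrite !hornerD !hornerC; ring.
Qed.

Lemma integral_sum (I : finType) (P : pred I) (F : I -> {poly K}) c d :
  integral (\sum_(i | P i) F i) c d = \sum_(i | P i) integral (F i) c d.
Proof.
rewrite (@integralE (\sum_(i | P i) primitive (F i))).
  by rewrite !horner_sum -sumrB.
by rewrite raddf_sum /=; apply: eq_bigr => i _; rewrite deriv_primitive.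
Qed.

Lemma integralMC q a c d : integral (a%:P * q) c d = a * integral q c d.
Proof.
rewrite (@integralE (a%:P * primitive q)).
  by rewrite /integral mulrBr !hornerM !hornerC.
by rewrite derivM derivC deriv_primitive mul0r add0r.
Qed.

Lemma integral_const a c d : integral a%:P c d = a * (d - c).
Proof.
rewrite (@integralE (a%:P * 'X)); first by rewrite !hornerM !hornerC !hornerX mulrBr.
by rewrite derivM derivC derivX mul0r add0r mulr1.
Qed.

Lemma integral_affine q a b c d :
  a * integral (q \Po (a%:P * 'X + b%:P)) c d = integral q (a * c + b) (a * d + b).
Proof.
rewrite -integralMC (@integralE (primitive q \Po (a%:P * 'X + b%:P))).
  by rewrite /integral !horner_comp !hornerE.
by rewrite deriv_comp deriv_primitive derivD derivM !derivC derivX; ring.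
Qed.

Lemma integral_swap q c d : integral q c d = - integral q d c.
Proof. by rewrite /integral opprB. Qed.

End Integral.

(** * Averages over conjugacy classes *)

Section Hecke.
Variables (K : numClosedFieldType) (l : nat).
Notation n := (l + l)%N.
Variable p : 'I_n -> K.
Implicit Types (f g h F : {set 'I_n}) (psi phi : {set 'I_n} -> K).

Definition scalar_sub (R : comNzRingType) (x : R) (A : bool -> bool -> R) :
  bool -> bool -> R := fun i j => x * (i == j)%:R - A i j.

(** A path of matrices with eigenvalues z and w, upper triangular at both of its
    ends, the parameters w and z. *)
Definition shear_orbit (z w : K) : bool -> bool -> {poly K} :=
  mat2 'X 1 ((z%:P - 'X) * ('X - w%:P)) ((z + w)%:P - 'X).

Definition amplitude z w psi : {set 'I_n} -> {poly K} :=
  kron_app (fun s => scalar_sub (p s)%:P (shear_orbit z w)) (fun g => (psi g)%:P).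

(** This is z - w times the mean of the tensor product of the matrices p s - A,
    for A among the unitary conjugates of diag(z, w), applied to psi. Averaging
    over the diagonal torus keeps the entries between subsets of the same size,
    where only the product of the off-diagonal entries of A matters, and what
    remains of the invariant measure is the uniform measure of the first entry
    of A on the segment from w to z. *)
Definition hecke z w psi f : K :=
  if #|f| == l then integral (amplitude z w psi f) w z else 0.

(** The highest weight vectors of weight zero, that is, the invariants of SL2. *)
Definition invariant psi := supported l psi /\ forall F, raise psi F = 0.

Lemma invariant_shear psi : invariant psi -> shear_fixed l psi.
Proof. by move=> [sup ra]; apply: raise_shear_fixed. Qed.

Lemma invariant_coshear psi : invariant psi -> coshear_fixed l psi.
Proof.
by move=> [sup ra]; apply: lower_coshear_fixed => //; apply: raise_lower_eq0 sup ra.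
Qed.

Lemma supportedC psi : supported l psi -> supported l (fun f => (psi f)%:P).
Proof. by move=> sup f /sup ->. Qed.

Lemma shear_fixedC psi : shear_fixed l psi -> shear_fixed l (fun f => (psi f)%:P).
Proof. by move=> fx f /fx; rewrite -raddf_sum => ->. Qed.

Lemma coshear_fixedC psi : coshear_fixed l psi -> coshear_fixed l (fun f => (psi f)%:P).
Proof. by move=> fx f /fx; rewrite -raddf_sum => ->. Qed.

Lemma supported_hecke z w psi : supported l (hecke z w psi).
Proof. by move=> f /negPf; rewrite /hecke => ->. Qed.

(** The members of the family are conjugate to each other by shears, since
    their derivative is a commutator with a nilpotent matrix. *)
Lemma scalar_sub_orbit z w x i j :
  scalar_sub x%:P (shear_orbit z w) i j =
  mul2 (shear (- 'X)) (mul2 (scalar_sub x%:P (mat2 0 1 (- (z * w))%:P (z + w)%:P)) (shear 'X)) i j.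
Proof.
rewrite /scalar_sub /shear_orbit /mul2 /shear /mat2; case: i j => -[] /=; rewrite ?polyCN ?polyCM ?polyCD; ring.
Qed.

(** The shear on the right of each matrix fixes psi, so that the path acts on
    psi by a shear of a constant vector. *)
Lemma amplitude_shear z w psi : invariant psi -> exists eta, forall f,
  amplitude z w psi f =
  \sum_(g : {set 'I_n} | g \subset f) (- 'X) ^+ #|f :\: g| * (eta g)%:P.
Proof.
move=> inv; have [sup _] := inv; have fx := invariant_shear inv.
exists (kron_app (fun s => scalar_sub (p s) (mat2 0 1 (- (z * w)) (z + w))) psi) => f.
pose base s := scalar_sub (p s)%:P (mat2 0 1 (- (z * w))%:P (z + w)%:P).
pose conj s := mul2 (shear (- 'X)) (mul2 (base s) (shear 'X)).
rewrite /amplitude (@eq_kron_app _ _ _ conj); last by move=> s; apply: scalar_sub_orbit.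
rewrite -kron_appM {1}/kron_app [RHS]big_mkcond /=; apply: eq_bigr => g _.
rewrite kron_shear; case: ifP => _; rewrite ?mul0r //; congr (_ * _).
rewrite -kron_appM raddf_sum /=; apply: eq_bigr => h _.
rewrite (kron_app_shear _ (supportedC sup) (shear_fixedC fx)) polyCM.
congr (_ * _); rewrite /kron rmorph_prod /=; apply: eq_bigr => s _.
rewrite /scalar_sub polyCB polyCM; congr (_ - _); last by case: (s \in g) (s \in h) => -[].
by case: eqP.
Qed.

(** Differentiating the shear along the path gives the raising operator. *)
Lemma deriv_amplitude z w psi F : invariant psi ->
  (amplitude z w psi F)^`() = - raise (amplitude z w psi) F.
Proof.
move=> /(amplitude_shear z w) [eta ampE]; rewrite ampE raddf_sum /raise /=.
under [in RHS]eq_bigr do rewrite ampE.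
rewrite (exchange_big_dep (fun g => g \subset F)) /=; last first.
  by move=> s g sF /subset_trans; apply; rewrite subD1set.
rewrite -sumrN; apply: eq_bigr => g gF.
transitivity (- \sum_(s in F :\: g) (- 'X) ^+ (#|F :\: g|).-1 * (eta g)%:P).
  rewrite sumr_const derivM derivC mulr0 addr0 deriv_exp derivN derivX mulN1r.
  by rewrite mulNrn mulNr mulrnAl.
congr (- _); apply: eq_big => s; first by rewrite inE subsetD1 gF /= andbC.
rewrite inE => /andP[sg sF]; congr (_ ^+ _ * _).
by rewrite (cardsD1 s (F :\: g)) inE sg sF /= setDDl setUC -setDDl.
Qed.

Lemma amplitude_end z w psi F t : invariant psi -> (l < #|F|)%N ->
  (t == z) || (t == w) -> (amplitude z w psi F).[t] = 0.
Proof.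
move=> [sup _] lF tzw; rewrite /amplitude /kron_app horner_sum big1 // => g _.
rewrite hornerM hornerC; have [gl|/sup ->] := eqVneq #|g| l; last by rewrite mulr0.
suff -> : (kron (fun s => scalar_sub (p s)%:P (shear_orbit z w)) F g).[t] = 0 by rewrite mul0r.
rewrite /kron horner_prod; apply: (@kron_upper _ _ (fun s i j =>
  (scalar_sub (p s)%:P (shear_orbit z w) i j).[t])); last by rewrite gl.
move=> s; rewrite /scalar_sub /shear_orbit /mat2 /= !hornerE.
by case/orP: tzw => /eqP->; ring.
Qed.

(** The raising operator turns the integral of the amplitude into a boundary
    term, and at both ends the matrices are triangular. *)
Lemma hecke_invariant z w psi : invariant psi -> invariant (hecke z w psi).
Proof.
move=> inv; split; first exact: supported_hecke.
move=> F; rewrite /raise.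
have [cF|cF] := eqVneq #|F| l.+1; last first.
  apply: big1 => s sF; apply: supported_hecke; apply: contra cF => /eqP e.
  by apply/eqP; have := cardsD1 s F; rewrite sF e.
transitivity (integral (raise (amplitude z w psi) F) w z).
  rewrite integral_sum; apply: eq_bigr => s sF; rewrite /hecke.
  have e : #|F :\ s| = l by have := cardsD1 s F; rewrite sF cF => -[].
  by rewrite e eqxx.
rewrite (@integralE _ (- amplitude z w psi F)).
  by rewrite !hornerN !amplitude_end ?cF ?eqxx ?orbT // subrr.
by rewrite derivN deriv_amplitude // opprK.
Qed.

End Hecke.

(** * The Pluecker relation *)
Section Pluecker.
Variables (K : numClosedFieldType) (l : nat).
Notation n := (l + l)%N.
Variable p : 'I_n -> K.
Implicit Types (f g h F : {set 'I_n}) (psi phi u v : {set 'I_n} -> K).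
Implicit Types a b c d : K.
Notation hecke := (hecke p).
Notation amplitude := (amplitude p).

Definition diag_weight a b f : K := \prod_s (p s - if s \in f then b else a).

Lemma pairing_integral (u : {set 'I_n} -> K) c d psi : supported l u ->
  pairing u (hecke c d psi)
  = integral (pairing (fun f => (u f)%:P) (amplitude c d psi)) d c.
Proof.
move=> su; rewrite integral_sum; apply: eq_bigr => f _; rewrite integralMC /hecke.
by case: eqP => // /eqP/su ->; rewrite !mul0r.
Qed.

Lemma pairing_amplitude_const c d phi psi : invariant phi -> invariant psi ->
  exists C, pairing (fun f => (phi f)%:P) (amplitude c d psi) = C%:P.
Proof.
move=> iphi ipsi; pose base s := scalar_sub (p s) (mat2 0 1 (- (c * d)) (c + d)).
exists (pairing phi (kron_app base psi)).
pose baseP s i j := (base s i j)%:P.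
pose conj s := mul2 (shear (- 'X)) (mul2 (baseP s) (shear 'X)).
have baseE s i j : baseP s i j = scalar_sub (p s)%:P (mat2 0 1 (- (c * d))%:P (c + d)%:P) i j.
  rewrite /baseP /base /scalar_sub polyCB polyCM; congr (_ * _ - _); first by case: eqP.
  by case: i j => -[].
transitivity (pairing (fun f => (phi f)%:P) (kron_app conj (fun g => (psi g)%:P))).
  apply: eq_bigr => f _; congr (_ * _); apply: eq_kron_app => s i j.
  by rewrite scalar_sub_orbit /conj /mul2 !baseE.
rewrite /conj (pairing_conj_shear _ _ (supportedC (proj1 iphi))
  (coshear_fixedC (invariant_coshear iphi)) (supportedC (proj1 ipsi))
  (shear_fixedC (invariant_shear ipsi))).
rewrite -[RHS]/(polyC _) (rmorph_pairing polyC); apply: eq_bigr => f _.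
by rewrite (rmorph_kron_app polyC).
Qed.

(** Between invariants the integrand is constant by conjugation, and at the end
    a of the path the matrices are triangular with diagonal (a, b). *)
Lemma pairing_hecke a b phi psi : invariant phi -> invariant psi ->
  pairing phi (hecke a b psi) = (a - b) * pairing phi (fun f => diag_weight a b f * psi f).
Proof.
move=> iphi ipsi; have [sphi _] := iphi; have [spsi _] := ipsi.
rewrite pairing_integral //; have [C qC] := pairing_amplitude_const a b iphi ipsi.
rewrite qC integral_const mulrC; congr (_ * _).
have <- : (pairing (fun f => (phi f)%:P) (amplitude a b psi)).[a] = C by rewrite qC hornerC.
rewrite horner_sum; apply: eq_bigr => f _; rewrite hornerM hornerC.
have [lf|/sphi ->] := eqVneq #|f| l; last by rewrite !mul0r.
congr (_ * _); rewrite /amplitude /kron_app horner_sum (bigD1 f) //= big1 ?addr0.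
- rewrite hornerM hornerC /kron horner_prod; congr (_ * _); apply: eq_bigr => s _.
  by rewrite /scalar_sub /shear_orbit /mat2 eqxx; case: (s \in f); rewrite !hornerE //; ring.
- move=> g gf; rewrite hornerM hornerC.
  have [lg|/spsi ->] := eqVneq #|g| l; last by rewrite mulr0.
  rewrite /kron horner_prod.
  set X := fun s i j => (scalar_sub (p s)%:P (shear_orbit a b) i j).[a].
  rewrite [X in X * _](@kron_upper_eq _ _ X f g) ?lf ?lg //.
    by rewrite eq_sym (negPf gf) mul0r.
  by move=> s; rewrite /X /scalar_sub /shear_orbit /mat2 !hornerE; ring.
Qed.

(** Normal form, under conjugation by shears, of the product of two monic
    linear matrix polynomials; it depends on the roots b, c, d of the
    determinant only through their elementary symmetric functions. *)
Definition normal_form (R : comNzRingType) (a e1 e2 e3 kappa x : R) :=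
  mat2 (x * (x - a)) (- (x - a)) ((e2 - kappa) * x - e3) (x ^+ 2 - e1 * x + kappa).

(** The shear that makes the upper left entry of the product divisible by x
    also removes t from the other entries, except through the trace [kappa] of
    the constant term. *)
Lemma factor_normal_form (R : comNzRingType) (a b c d t x : R) i j :
  mul2 (scalar_sub x (mat2 a 0 0 b)) (scalar_sub x (mat2 t 1 ((c - t) * (t - d)) (c + d - t))) i j
  = mul2 (shear (- t)) (mul2
      (normal_form a (b + c + d) (b * c + b * d + c * d) (b * c * d)
                   ((a - b) * t + b * (c + d)) x) (shear t)) i j.
Proof.
by rewrite /scalar_sub /mul2 /shear /normal_form /mat2; case: i j => -[] /=; ring.
Qed.

Definition matrix_coefficient a e1 e2 e3 phi psi : {poly K} :=
  pairing (fun f => (phi f)%:P)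
   (kron_app (fun s => normal_form a%:P e1%:P e2%:P e3%:P 'X (p s)%:P)
             (fun g => (psi g)%:P)).

(** By [pairing_hecke] the first operator acts as (a - b) times diag(a, b). The
    second one is an integral along its path, where [kappa] is affine in the
    parameter with slope a - b, so that the factor a - b turns the integral into
    one over [kappa]; its integrand is symmetric in b, c and d. *)
Lemma pairing_hecke2 a b c d phi psi : invariant phi -> invariant psi ->
  pairing phi (hecke a b (hecke c d psi)) =
  integral (matrix_coefficient a (b + c + d) (b * c + b * d + c * d) (b * c * d) phi psi)
           (a * d + b * c) (a * c + b * d).
Proof.
move=> iphi ipsi; have [sphi _] := iphi; have [spsi _] := ipsi.
rewrite pairing_hecke //; last exact: hecke_invariant.
have -> : pairing phi (fun f => diag_weight a b f * hecke c d psi f)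
        = pairing (fun f => phi f * diag_weight a b f) (hecke c d psi).
  by apply: eq_bigr => f _; rewrite mulrA.
rewrite pairing_integral; last by move=> f /sphi ->; rewrite mul0r.
set kappa := (a - b)%:P * 'X + (b * (c + d))%:P.
set Q := matrix_coefficient _ _ _ _ _ _.
have -> : pairing (fun f => (phi f * diag_weight a b f)%:P) (amplitude c d psi) = Q \Po kappa.
  rewrite -[RHS]/(comp_poly kappa Q) (rmorph_pairing (comp_poly kappa)).
  have compC (r : K) : (r%:P : {poly K}) \Po kappa = r%:P by rewrite comp_polyC.
  pose X s := mul2 (shear (- 'X)) (mul2
      (normal_form a%:P (b + c + d)%:P (b * c + b * d + c * d)%:P (b * c * d)%:P
                   kappa (p s)%:P) (shear 'X)).
  transitivity (pairing (fun f => (phi f)%:P) (kron_app X (fun g => (psi g)%:P))).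
    apply: eq_bigr => f _; rewrite polyCM -mulrA; congr (_ * _).
    pose D s := scalar_sub (p s)%:P (mat2 a%:P 0 0 b%:P).
    rewrite (@eq_kron_app _ _ X (fun s => mul2 (D s) (scalar_sub (p s)%:P (shear_orbit c d)))).
      rewrite -kron_appM {1}/kron_app (bigD1 f) //= big1 ?addr0.
        rewrite kron_diag; last 2 first.
        - by move=> s; rewrite /D /scalar_sub /mat2 /=; ring.
        - by move=> s; rewrite /D /scalar_sub /mat2 /=; ring.
        rewrite eqxx /diag_weight rmorph_prod /=; congr (_ * _); apply: eq_bigr => s _.
        by rewrite /D /scalar_sub /mat2 eqxx mulr1 polyCB; case: (s \in f).
      move=> g gf; rewrite kron_diag; last 2 first.
      - by move=> s; rewrite /D /scalar_sub /mat2 /=; ring.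
      - by move=> s; rewrite /D /scalar_sub /mat2 /=; ring.
      by rewrite eq_sym (negPf gf) mul0r.
    move=> s i j; rewrite /X /kappa /D /shear_orbit !(polyCD, polyCM, polyCN).
    by rewrite factor_normal_form.
  rewrite /X (pairing_conj_shear _ _ (supportedC sphi)
    (coshear_fixedC (invariant_coshear iphi)) (supportedC spsi)
    (shear_fixedC (invariant_shear ipsi))).
  apply: eq_bigr => f _; rewrite /= compC; congr (_ * _).
  rewrite -[RHS]/(comp_poly kappa _) (rmorph_kron_app (comp_poly kappa)).
  apply: eq_bigr => g _; rewrite /= compC; congr (_ * _); apply: eq_kron => s i j.
  rewrite /normal_form /mat2.
  by case: i j => -[] /=; rewrite !(rmorphD, rmorphB, rmorphN, rmorphM, rmorphXn) /= ?compC ?comp_polyX.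
rewrite integral_affine; congr (integral _ _ _); ring.
Qed.

(** The complex conjugate of an invariant is an invariant, so the pairing is
    nondegenerate on invariants. *)
Lemma invariant_ext phi psi : invariant phi -> invariant psi ->
  (forall chi, invariant chi -> pairing chi phi = pairing chi psi) -> phi =1 psi.
Proof.
move=> [sphi rphi] [spsi rpsi] H.
pose chi f := (phi f - psi f)^*.
have ichi : invariant chi.
  split=> [f lf|F]; first by rewrite /chi sphi // spsi // subrr conjC0.
  rewrite /raise /chi -rmorph_sum sumrB -/(raise phi F) -/(raise psi F).
  by rewrite rphi rpsi subrr rmorph0.
have chi0 : pairing (fun f => phi f - psi f) (fun f => (phi f - psi f)^*) = 0.
  transitivity (pairing chi phi - pairing chi psi); last by rewrite H // subrr.
  by rewrite /pairing -[RHS]sumrB; apply: eq_bigr => f _; rewrite -mulrBr mulrC.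
by move=> f; apply/eqP; rewrite -subr_eq0; apply/eqP; apply: (pairing_conj_eq0 chi0).
Qed.

Lemma pairingD phi u v : pairing phi (fun f => u f + v f) = pairing phi u + pairing phi v.
Proof. by rewrite /pairing -big_split; apply: eq_bigr => f _; rewrite mulrDr. Qed.

Lemma invariantD u v : invariant u -> invariant v -> invariant (fun f => u f + v f).
Proof.
move=> [su ru] [sv rv]; split=> [f lf|F]; first by rewrite su // sv // addr0.
transitivity (raise u F + raise v F); last by rewrite ru rv addr0.
by rewrite -[RHS]big_split.
Qed.

(** The three products are integrals of one function between two of the numbers
    a b + c d, a c + b d and a d + b c, and integrals are additive. *)
Lemma pluecker_pairing a b c d phi psi : invariant phi -> invariant psi ->
  pairing phi (hecke a b (hecke c d psi)) + pairing phi (hecke a d (hecke b c psi))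
  = pairing phi (hecke a c (hecke b d psi)).
Proof.
move=> iphi ipsi; rewrite !pairing_hecke2 //.
rewrite (_ : d + b + c = b + c + d); last by ring.
rewrite (_ : c + b + d = b + c + d); last by ring.
rewrite (_ : d * b + d * c + b * c = b * c + b * d + c * d); last by ring.
rewrite (_ : c * b + c * d + b * d = b * c + b * d + c * d); last by ring.
rewrite (_ : d * b * c = b * c * d); last by ring.
rewrite (_ : c * b * d = b * c * d); last by ring.
rewrite (_ : c * b = b * c) 1?mulrC // (_ : d * b = b * d) 1?mulrC // (_ : d * c = c * d) 1?mulrC //.
rewrite /integral; ring.
Qed.

Lemma hecke_pluecker a b c d psi f : invariant psi ->
  hecke a b (hecke c d psi) f + hecke a d (hecke b c psi) f
  = hecke a c (hecke b d psi) f.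
Proof.
move=> ipsi.
apply: (invariant_ext (phi := fun f => hecke a b (hecke c d psi) f + hecke a d (hecke b c psi) f)).
- by apply: invariantD; do 2!apply: hecke_invariant.
- by do 2!apply: hecke_invariant.
by move=> chi ichi; rewrite pairingD pluecker_pairing.
Qed.

(** The path from w to z is the path from z to w run backwards. *)
Lemma hecke_antisym a b psi f : hecke a b psi f = - hecke b a psi f.
Proof.
rewrite /hecke; case: ifP => _; rewrite ?oppr0 // [LHS]integral_swap; congr (- integral _ _ _).
rewrite /amplitude; apply: eq_kron_app => s i j.
by rewrite /scalar_sub /shear_orbit /mat2 (addrC b a); case: i j => -[] //=; ring.
Qed.

End Pluecker.

(** * Common eigenvectors *)

Lemma subspace_vspace (K : fieldType) (V : vectType K) (S : V -> Prop) :
  S 0 -> (forall a u v, S u -> S v -> S (a *: u + v)) ->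
  exists U : {vspace V}, forall v, v \in U <-> S v.
Proof.
move=> S0 SD.
suff H k : (exists U : {vspace V}, forall v, v \in U <-> S v) \/
    (exists U : {vspace V}, (forall v, v \in U -> S v) /\ (k <= \dim U)%N).
  have [//|[U [_ dU]]] := H (\dim {:V}).+1.
  by have := leq_trans dU (dimvS (subvf U)); rewrite ltnn.
elim: k => [|k [?|[U [US dU]]]]; first by right; exists 0%VS; split=> // v; rewrite memv0 => /eqP->.
  by left.
have [[v [Sv vU]]|none] := classic (exists v, S v /\ v \notin U); last first.
  left; exists U => v; split=> [/US//|Sv]; apply: contraT => vU.
  by case: none; exists v.
right; exists (U + <[v]>)%VS; split.
  move=> w /memv_addP[u uU [x /vlineP[c ->] ->]].
  by rewrite addrC; apply: SD => //; apply: US.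
apply: leq_ltn_trans dU _; rewrite ltnNge; apply: contra vU => le.
have /eqP -> : (U == U + <[v]>)%VS by rewrite eqEdim addvSl.
by rewrite memvE addvSr.
Qed.

Lemma eigenvector_vspace (K : numClosedFieldType) (V : vectType K) (f : 'End(V))
    (U : {vspace V}) : (f @: U <= U)%VS -> U != 0%VS ->
  exists c, exists2 v, v \in U & v != 0 /\ f v = c *: v.
Proof.
move=> fU U0; pose b := vbasis U.
pose A : 'M[K]_(\dim U) := \matrix_(i, j) coord b j (f b`_i).
have [|c /eigenvalueP[x xA x0]] := eigenvalue_closed A; first by rewrite lt0n dimv_eq0.
have bU := vbasisP U.
have fb (i : 'I_(\dim U)) : f b`_i = \sum_j A i j *: b`_j.
  have : f b`_i \in U.
    by apply: (subvP fU); rewrite memv_img // (basis_mem bU) // mem_nth // size_tuple.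
  by move/(coord_basis bU) => {1}->; apply: eq_bigr => j _; rewrite mxE.
exists c; exists (\sum_i x 0 i *: b`_i).
  rewrite memv_suml // => i _; rewrite memvZ // (basis_mem bU) // mem_nth // size_tuple //.
split.
  apply: contra x0 => /eqP H; apply/eqP/rowP => i; rewrite mxE.
  by have /freeP -> := basis_free bU.
rewrite linear_sum scaler_sumr.
under eq_bigr => i _ do rewrite linearZ /= fb scaler_sumr.
rewrite exchange_big /=; apply: eq_bigr => j _.
have /rowP/(_ j) := xA; rewrite !mxE scalerA => <-.
by rewrite scaler_suml; apply: eq_bigr => i _; rewrite scalerA.
Qed.

(** If one of the operators is not a scalar on U, it has in U an eigenspace that
    is smaller than U, and the others preserve it. *)
Lemma common_eigenvector_vspace (K : numClosedFieldType) (V : vectType K) (I : Type)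
    (f : I -> 'End(V)) (U : {vspace V}) : U != 0%VS ->
  (forall i, (f i @: U <= U)%VS) ->
  (forall i j v, v \in U -> f i (f j v) = f j (f i v)) ->
  exists2 v, v \in U & v != 0 /\ forall i, exists c, f i v = c *: v.
Proof.
have [k] := ubnP (\dim U); elim: k U => [//|k IHk] U; rewrite ltnS => dU U0 fU fC.
have [scal|nscal] := classic (forall i, exists c, forall v, v \in U -> f i v = c *: v).
  exists (vpick U); first exact: memv_pick.
  split; first by rewrite vpick0.
  by move=> i; have [c fc] := scal i; exists c; rewrite fc ?memv_pick.
have [i ni] : exists i, ~ exists c, forall v, v \in U -> f i v = c *: v.
  by apply: NNPP => H; apply: nscal => i; apply: NNPP => ni; apply: H; exists i.
have [c [v vU [v0 fv]]] := eigenvector_vspace (fU i) U0.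
pose E := lker (f i - c *: \1%VF); pose W := (U :&: E)%VS.
have WE w : (w \in W) = (w \in U) && (f i w == c *: w).
  by rewrite memv_cap memv_ker add_lfunE opp_lfunE scale_lfunE id_lfunE subr_eq0.
have WU : (W <= U)%VS by apply: capvSl.
have [||||w wW [w0 fw]] := IHk W.
- apply: leq_trans dU; rewrite ltnNge; apply/negP => dW.
  apply: ni; exists c => u uU; apply/eqP.
  have /eqP e : W == U by rewrite eqEdim WU.
  by move: uU; rewrite -e WE => /andP[].
- by apply: contra v0 => /eqP W0; rewrite -memv0 -W0 WE vU fv eqxx.
- move=> j; apply/subvP => _ /memv_imgP[w wW ->]; move: wW; rewrite !WE => /andP[wU /eqP fw].
  by rewrite (subvP (fU j)) ?memv_img // fC // fw linearZ /=.
- by move=> j j' w /(subvP WU); apply: fC.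
by exists w => //; apply: (subvP WU).
Qed.

(** * Commutation and the common eigenvector *)
Section Commutation.
Variables (K : numClosedFieldType) (l : nat).
Notation n := (l + l)%N.
Variable p : 'I_n -> K.
Implicit Types (f g h F : {set 'I_n}) (psi phi u v : {set 'I_n} -> K).
Implicit Types a b c d : K.
Notation hecke := (hecke p).

Lemma hecke_sum a b psi f : hecke a b psi f =
  if #|f| == l then
    \sum_(g : {set 'I_n}) psi g *
      integral (kron (fun s => scalar_sub (p s)%:P (shear_orbit a b)) f g) b a
  else 0.
Proof.
rewrite /RationalPencils.hecke; case: ifP => // _; rewrite integral_sum; apply: eq_bigr => g _.
by rewrite mulrC integralMC.
Qed.

Lemma hecke_linear a b k u v f :
  hecke a b (fun g => k * u g + v g) f = k * hecke a b u f + hecke a b v f.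
Proof.
rewrite !hecke_sum; case: ifP => _; last by rewrite mulr0 addr0.
rewrite mulr_sumr -big_split; apply: eq_bigr => g _ /=; ring.
Qed.

Lemma eq_hecke a b u v : u =1 v -> hecke a b u =1 hecke a b v.
Proof.
move=> uv f; rewrite !hecke_sum; case: ifP => // _.
by apply: eq_bigr => g _; rewrite uv.
Qed.

(** Commutativity is formal: by the Pluecker relation, rotating b, c and d
    changes the sign of the commutator, and three rotations restore it. *)
Lemma hecke_comm a b c d psi : invariant psi ->
  hecke a b (hecke c d psi) =1 hecke c d (hecke a b psi).
Proof.
move=> ipsi f; pose X a b c d := hecke a b (hecke c d psi) f.
have pl a' b' c' d' : X a' b' c' d' + X a' d' b' c' = X a' c' b' d'.
  exact: hecke_pluecker.
have asl a' b' c' d' : X a' b' c' d' = - X b' a' c' d' by apply: hecke_antisym.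
have step a' b' c' d' :
    X a' b' c' d' - X c' d' a' b' = - (X a' d' b' c' - X b' c' a' d').
  have e1 := pl a' b' c' d'; have e2 := pl c' a' b' d'.
  rewrite (asl c' a') (asl c' b') in e2.
  have -> : X c' d' a' b' = - X b' c' a' d' + X a' c' b' d'.
    by rewrite -e2; ring.
  by rewrite -e1; ring.
have s1 := step a b c d; have s2 := step a d b c; have s3 := step a c d b.
have : (X a b c d - X c d a b) *+ 2 = 0.
  rewrite mulr2n {1}s1 s2 opprK.
  by rewrite s3 addNr.
by move=> /eqP; rewrite mulrn_eq0 /= subr_eq0 => /eqP.
Qed.

(** Slots carrying the same point p s are interchangeable; these vectors form
    the tensor product of the symmetric powers attached to the points. *)
Definition slot_symmetric psi := forall sigma : 'S_n,
  (forall s, p (sigma s) = p s) -> forall f, psi (sigma @: f) = psi f.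

Lemma mem_perm_imset (sigma : 'S_n) s f : (sigma s \in sigma @: f) = (s \in f).
Proof. by rewrite mem_imset //; apply: perm_inj. Qed.

Lemma hecke_symmetric a b psi : slot_symmetric psi -> slot_symmetric (hecke a b psi).
Proof.
move=> sym sigma sp f; rewrite !hecke_sum card_imset; last exact: perm_inj.
case: ifP => // _; rewrite (reindex_inj (imset_inj (@perm_inj _ sigma))) /=.
apply: eq_bigr => g _; rewrite sym //; congr (_ * integral _ _ _).
rewrite /kron (reindex_inj (@perm_inj _ sigma)) /=; apply: eq_bigr => s _.
by rewrite !mem_perm_imset sp.
Qed.

Definition symmetrize psi f : K :=
  \sum_(sigma : 'S_n | [forall s, p (sigma s) == p s]) psi (sigma @: f).

Lemma symmetrize_symmetric psi : slot_symmetric (symmetrize psi).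
Proof.
move=> tau tp f; rewrite /symmetrize.
rewrite [RHS](reindex_inj (mulgI tau)) /=; apply: eq_big => sigma.
  apply/forallP/forallP => H s; first by rewrite permM (eqP (H _)) tp.
  have := H (tau^-1%g s); rewrite permM permKV => /eqP ->.
  by have := tp (tau^-1%g s); rewrite permKV => ->.
by move=> _; congr psi; rewrite -imset_comp; apply: eq_imset => s; rewrite /= permM.
Qed.

Lemma symmetrize_invariant psi : invariant psi -> invariant (symmetrize psi).
Proof.
move=> [sup ra]; split=> [f lf|F].
  by apply: big1 => sigma _; apply: sup; rewrite card_imset //; apply: perm_inj.
rewrite /raise exchange_big /=; apply: big1 => sigma _.
rewrite -[RHS](ra (sigma @: F)) /raise [RHS](reindex_inj (@perm_inj _ sigma)) /=.
apply: eq_big => [s|s _]; first by rewrite mem_perm_imset.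
congr psi; apply/setP => t; rewrite -[t](permKV sigma) mem_perm_imset.
by rewrite !inE mem_perm_imset (inj_eq perm_inj).
Qed.

(** The classical invariant of 2 l vectors that multiplies the determinants of
    the pairs of slots (i, l + i). *)
Definition brackets f : K :=
  \prod_(i < l) ((rshift l i \in f)%:R - (lshift l i \in f)%:R).

Lemma brackets_invariant : invariant brackets.
Proof.
split=> [f lf|F].
  have [i ei] : exists i, (rshift l i \in f) == (lshift l i \in f).
    apply/existsP; apply: contraR lf; rewrite negb_exists => /forallP H.
    rewrite -sum1_card big_mkcond /= big_split_ord /= -big_split /=.
    rewrite (eq_bigr (fun=> 1%N)) ?sum1_card ?card_ord // => i _.
    by have := H i; do 2 case: (_ \in f).
  by rewrite /brackets (bigD1 i) //= (eqP ei) subrr mul0r.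
rewrite /raise big_mkcond /= big_split_ord /= -big_split big1 //= => i _.
have fac (e : 'I_n) : e = lshift l i \/ e = rshift l i ->
   brackets (F :\ e) = ((rshift l i \in F :\ e)%:R - (lshift l i \in F :\ e)%:R) *
     \prod_(j < l | j != i) ((rshift l j \in F)%:R - (lshift l j \in F)%:R).
  move=> de; rewrite /brackets (bigD1 i) //=; congr (_ * _).
  apply: eq_bigr => j ji; rewrite !inE.
  have -> : (rshift l j != e).
    by case: de => ->; rewrite ?eq_rlshift ?(inj_eq (@rshift_inj _ _)).
  have -> // : (lshift l j != e).
  by case: de => ->; rewrite ?eq_lrshift ?(inj_eq (@lshift_inj _ _)).
rewrite !fac; [|by right|by left].
rewrite !inE !eqxx eq_rlshift eq_lrshift /=.
by case: (lshift l i \in F); case: (rshift l i \in F) => /=; ring.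
Qed.

(** The tensor product of the vectors (1, p s), on which the bracket of two slots
    takes the difference of their points as its value. *)
Definition test_vector f : K := \prod_s (if s \in f then p s else 1).

(** Each bracket is a difference of two terms; the set T records which of them
    is chosen in each pair, after which the sum over f factors. *)
Lemma pairing_test_brackets :
  pairing test_vector brackets = \prod_(i < l) (p (rshift l i) - p (lshift l i)).
Proof.
pose E f (T : {set 'I_l}) i : K :=
  if i \in T then (rshift l i \in f)%:R else - (lshift l i \in f)%:R.
pose W (T : {set 'I_l}) (s : 'I_n) (b : bool) : K := (if b then p s else 1) *
   match split s with
   | inl i => if i \in T then 1 else - b%:R
   | inr i => if i \in T then b%:R else 1
   end.
transitivity (\sum_(f : {set 'I_n}) \sum_(T : {set 'I_l}) \prod_s W T s (s \in f)).
  apply: eq_bigr => f _.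
  have -> : brackets f = \sum_(T : {set 'I_l}) \prod_i E f T i.
    rewrite (sum_prod_sets (fun i (e : bool) =>
      if e then (rshift l i \in f)%:R else - (lshift l i \in f)%:R)).
    by apply: eq_bigr => i _; rewrite addrC.
  rewrite mulr_sumr; apply: eq_bigr => T _.
  rewrite big_split /=; congr (_ * _); rewrite big_split_ord /= -big_split /=.
  apply: eq_bigr => i _; rewrite (unsplitK (inl i)) (unsplitK (inr i)) /E.
  by case: (i \in T); rewrite ?mul1r ?mulr1.
rewrite exchange_big /=.
under eq_bigr => T _ do rewrite (sum_prod_sets (W T)) big_split_ord /= -big_split /=.
transitivity (\sum_(T : {set 'I_l}) \prod_i
   (if i \in T then (1 + p (lshift l i)) * p (rshift l i)
    else - p (lshift l i) * (1 + p (rshift l i)))).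
  apply: eq_bigr => T _; apply: eq_bigr => i _.
  by rewrite /W (unsplitK (inl i)) (unsplitK (inr i)); case: (i \in T) => /=; ring.
rewrite (sum_prod_sets (fun i (e : bool) => if e then (1 + p (lshift l i)) * p (rshift l i)
    else - p (lshift l i) * (1 + p (rshift l i)))).
by apply: eq_bigr => i _ /=; ring.
Qed.

Hypothesis p_apart : forall i : 'I_l, p (lshift l i) != p (rshift l i).

(** Symmetrization multiplies the pairing with a symmetric tensor by the number
    of permutations, so it cannot kill the brackets. *)
Lemma exists_invariant : exists psi,
  [/\ invariant psi, slot_symmetric psi & exists f, psi f != 0].
Proof.
exists (symmetrize brackets); split.
- exact/symmetrize_invariant/brackets_invariant.
- exact: symmetrize_symmetric.
apply: NNPP => zero.
have : pairing test_vector (symmetrize brackets) = 0.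
  apply: big1 => f _; have [->|nz] := eqVneq (symmetrize brackets f) 0; first exact: mulr0.
  by case: zero; exists f.
pose G := [pred sigma : 'S_n | [forall s, p (sigma s) == p s]].
have -> : pairing test_vector (symmetrize brackets) =
    pairing test_vector brackets *+ #|G|.
  rewrite /pairing; under eq_bigr do rewrite mulr_sumr.
  rewrite exchange_big /= -sumr_const; apply: eq_bigr => sigma /forallP sp.
  rewrite [RHS](reindex_inj (imset_inj (@perm_inj _ sigma))) /=.
  apply: eq_bigr => f _; congr (_ * _).
  rewrite /test_vector [RHS](reindex_inj (@perm_inj _ sigma)) /=.
  by apply: eq_bigr => s _; rewrite mem_perm_imset (eqP (sp s)).
apply/eqP; rewrite mulrn_eq0 negb_or; apply/andP; split.
  by rewrite -lt0n; apply/card_gt0P; exists 1%g; rewrite inE; apply/forallP => s; rewrite perm1.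
rewrite pairing_test_brackets prodf_seq_neq0; apply/allP => i _ /=.
by rewrite subr_eq0 eq_sym.
Qed.

Lemma exists_eigenvector : exists psi,
  [/\ invariant psi, slot_symmetric psi, exists f, psi f != 0
    & forall a b, exists c, forall f, hecke a b psi f = c * psi f].
Proof.
pose V := {ffun {set 'I_n} -> K^o}.
pose S (u : V) := invariant (u : {set 'I_n} -> K) /\ slot_symmetric (u : {set 'I_n} -> K).
have [||U US] := @subspace_vspace K V S.
- split; first split=> [f _|F]; rewrite ?ffunE //.
    by rewrite /raise big1 // => s _; rewrite ffunE.
  by move=> sigma _ f; rewrite !ffunE.
- move=> a u v [[su ru] yu] [[sv rv] yv]; split; first split=> [f lf|F].
  + by rewrite !ffunE su // sv // scaler0 addr0.
  + rewrite /raise; under eq_bigr do rewrite !ffunE.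
    transitivity (a * raise u F + raise v F); last by rewrite ru rv mulr0 addr0.
    by rewrite /raise mulr_sumr -[RHS]big_split.
  + by move=> sigma sp f; rewrite !ffunE yu // yv.
pose T (ab : K * K) (u : V) : V := [ffun f => hecke ab.1 ab.2 u f].
have T_linear ab : linear (T ab).
  move=> k u v; apply/ffunP => f; rewrite !ffunE -[RHS]hecke_linear.
  by apply: eq_hecke => g; rewrite !ffunE.
pose TL ab : {linear V -> V} :=
  HB.pack (T ab) (GRing.isLinear.Build K V V _ (T ab) (T_linear ab)).
have TE ab (u : V) f : linfun (TL ab) u f = hecke ab.1 ab.2 u f.
  by rewrite lfunE /= ffunE.
have [||| psi psiU [psi0 psiE]] :=
    @common_eigenvector_vspace K V (K * K)%type (fun ab => linfun (TL ab)) U.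
- have [psi [ipsi ypsi [f nz]]] := exists_invariant.
  apply: contraNneq nz => U0.
  have : ([ffun g => psi g] : V) \in U.
    apply/US; split; first (split=> [g lg|F]; first by rewrite ffunE ipsi.1).
      by rewrite -[RHS](ipsi.2 F); apply: eq_bigr => s _; rewrite ffunE.
    by move=> sigma sp g; rewrite !ffunE ypsi.
  by rewrite U0 memv0 => /eqP/ffunP/(_ f); rewrite !ffunE => ->.
- move=> ab; apply/subvP => _ /memv_imgP[u /US[iu yu] ->]; apply/US.
  have e g : hecke ab.1 ab.2 u g = linfun (TL ab) u g by rewrite TE.
  have [s r] := hecke_invariant p ab.1 ab.2 iu.
  split; first (split=> [g lg|F]; first by rewrite -e s).
    by rewrite -[RHS](r F); apply: eq_bigr => t _; rewrite e.
  by move=> sigma sp g; rewrite -!e hecke_symmetric.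
- move=> ab cd u /US[iu _]; apply/ffunP => f; rewrite !TE.
  rewrite (eq_hecke _ _ (TE cd u)) (eq_hecke _ _ (TE ab u)).
  exact: hecke_comm.
have [ipsi ypsi] := iffLR (US psi) psiU.
exists psi; split=> //.
  apply: NNPP => zero; case/eqP: psi0; apply/ffunP => f; rewrite ffunE.
  by apply/eqP; apply: contraT => nz; case: zero; exists f.
move=> a b; have [c e] := psiE (a, b); exists c => f.
by rewrite -[LHS](TE (a, b)) e ffunE.
Qed.
End Commutation.

Lemma poly_ext (K : closedFieldType) (P Q : {poly K}) :
  (forall x, P.[x] = Q.[x]) -> P = Q.
Proof.
move=> PQ; apply/eqP; rewrite -subr_eq0; apply: contraT => /closed_nonrootP[x].
by rewrite /root hornerD hornerN PQ subrr eqxx.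
Qed.

(** * The pencil attached to an eigenvector *)
Section Pencil.
Variables (K : numClosedFieldType) (l : nat).
Notation n := (l + l)%N.
Variable p : 'I_n -> K.

Variable psi : {set 'I_n} -> K.
Hypothesis psi_inv : invariant psi.
Hypothesis psi_sym : slot_symmetric p psi.
Variable f0 : {set 'I_n}.
Hypothesis psi_f0 : psi f0 != 0.
Hypothesis psi_eig : forall a b, exists c, forall f, hecke p a b psi f = c * psi f.

Let norm := pairing (fun f => (psi f)^*) psi.

Let norm_neq0 : norm != 0.
Proof.
apply: contra psi_f0 => /eqP H; apply/eqP; apply: pairing_conj_eq0.
by rewrite -[RHS]H; apply: eq_bigr => f _; rewrite mulrC.
Qed.

Definition density f : K := (psi f)^* * psi f / norm.

Lemma sum_density : \sum_(f : {set 'I_n}) density f = 1.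
Proof. by rewrite -mulr_suml divff. Qed.

Lemma sq_psi_ge0 f : 0 <= (psi f)^* * psi f.
Proof. by rewrite mulrC mul_conjC_ge0. Qed.

Lemma density_supported : supported l density.
Proof. by move=> f /psi_inv.1 e; rewrite /density e mulr0 mul0r. Qed.

Definition slot_poly (z : K) (f : {set 'I_n}) : {poly K} :=
  \prod_s ((p s)%:P - if s \in f then 'X else z%:P).

(** The eigenvalue at (z, w), divided by z - w, as a polynomial in w: it is the
    matrix coefficient of diag(z, w) at psi. *)
Definition eigenpoly (z : K) : {poly K} := \sum_(f : {set 'I_n}) density f *: slot_poly z f.

Lemma horner_eigenpoly z w :
  (eigenpoly z).[w] = \sum_(f : {set 'I_n}) density f * diag_weight p z w f.
Proof.
rewrite horner_sum; apply: eq_bigr => f _; rewrite hornerZ horner_prod.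
congr (_ * _); apply: eq_bigr => s _.
by case: (s \in f); rewrite !hornerE.
Qed.

Lemma horner_eigenpoly_diag z : (eigenpoly z).[z] = \prod_s (p s - z).
Proof.
rewrite horner_eigenpoly.
transitivity ((\sum_(f : {set 'I_n}) density f) * \prod_s (p s - z)); last first.
  by rewrite sum_density mul1r.
rewrite mulr_suml; apply: eq_bigr => f _.
by congr (_ * _); rewrite /diag_weight; apply: eq_bigr => s _; rewrite if_same.
Qed.

(** The variable occurs in the slots of f only, and f has l elements. *)
Lemma size_eigenpoly z : (size (eigenpoly z) <= l.+1)%N.
Proof.
apply: (leq_trans (size_sum _ _ _)); apply/bigmax_leqP => f _.
have [lf|/density_supported ->] := eqVneq #|f| l; last by rewrite scale0r size_poly0.
apply: (leq_trans (size_scale_leq _ _)); apply: (leq_trans (size_poly_prod_leq _ _)).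
rewrite cardT size_enum_ord.
suff : (\sum_(s < n) size ((p s)%:P - (if s \in f then 'X else z%:P))%R <= n + l)%N by rewrite leq_subLR addnS ltnS.
apply: (@leq_trans (\sum_(s < n) (1 + (s \in f))%N)%N).
  apply: leq_sum => s _; case: (s \in f) => /=.
    by rewrite addrC -size_polyN opprD opprK -polyCN size_XaddC.
  by rewrite -polyCB addn0 size_polyC leq_b1.
rewrite big_split /= sum1_card card_ord leq_add2l.
apply: (@leq_trans #|f|); last by rewrite lf.
rewrite -sum1_card [leqRHS]big_mkcond /=.
by apply: leq_sum => s _; case: (s \in f).
Qed.

Let mu z w := (z - w) * (eigenpoly z).[w].

Lemma hecke_mu a b f : hecke p a b psi f = mu a b * psi f.
Proof.
have [c cE] := psi_eig a b; rewrite cE; congr (_ * _).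
have conj_inv : invariant (fun f => (psi f)^*).
  split=> [g lg|F]; first by rewrite psi_inv.1 // rmorph0.
  rewrite -[RHS](rmorph0 Num.conj) -(psi_inv.2 F) /raise raddf_sum.
  by apply: eq_bigr.
apply: (mulIf norm_neq0).
transitivity (pairing (fun f => (psi f)^*) (hecke p a b psi)).
  rewrite /norm /pairing mulr_sumr; apply: eq_bigr => g _; rewrite cE; ring.
rewrite (pairing_hecke p a b conj_inv psi_inv) /mu horner_eigenpoly -mulrA.
congr (_ * _); rewrite mulr_suml; apply: eq_bigr => g _; rewrite /density.
rewrite mulrAC divfK //; ring.
Qed.

Lemma mu_pluecker a b c d : mu a b * mu c d + mu a d * mu b c = mu a c * mu b d.
Proof.
have H a' b' c' d' : hecke p a' b' (hecke p c' d' psi) f0 = mu a' b' * mu c' d' * psi f0.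
  rewrite (@eq_hecke _ _ _ _ _ _ (fun g => mu c' d' * psi g + 0)); last first.
    by move=> g; rewrite hecke_mu addr0.
  rewrite (hecke_linear p a' b' (mu c' d') psi (fun=> 0)) hecke_mu.
  rewrite [X in _ + X](_ : _ = 0); first by ring.
  by rewrite hecke_sum; case: ifP => // _; rewrite big1 // => g _; rewrite mul0r.
apply: (mulIf psi_f0); have := hecke_pluecker p a b c d f0 psi_inv.
by rewrite !H mulrDl.
Qed.

(** Suppose that psi vanishes on all subsets that contain the fibre over x.
    When k + 1 slots of the fibre are missing from f, add one of them: the
    raising equation at the larger set has terms that miss k slots, which are
    known to vanish, and terms that are equal to psi f by symmetry. *)
Lemma exists_fibre_coordinate (x : K) : let J := [set s | p s == x] in
  exists f : {set 'I_n}, (J \subset f) && (psi f != 0).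
Proof.
move=> J; apply: NNPP => none.
have zero (f : {set 'I_n}) : J \subset f -> psi f = 0.
  by move=> Jf; apply/eqP; apply: contraT => nz; case: none; exists f; rewrite Jf nz.
suff H k (f : {set 'I_n}) : #|J :\: f| = k -> psi f = 0 by case/eqP: psi_f0; apply: (H _ f0 erefl).
elim: k f => [|k IHk] f Jf.
  by apply: zero; rewrite -setD_eq0 -cards_eq0 Jf.
have /card_gt0P[s0] : (0 < #|J :\: f|)%N by rewrite Jf.
rewrite inE => /andP[s0f s0J]; pose F := s0 |: f.
have cJF : #|J :\: F| = k.
  have -> : J :\: F = (J :\: f) :\ s0 by rewrite /F setUC setDDl.
  by have := cardsD1 s0 (J :\: f); rewrite Jf inE s0f s0J => -[].
have := psi_inv.2 F; rewrite /raise (bigID (mem J)) /=.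
rewrite [X in _ + X]big1 ?addr0; last first.
  move=> s /andP[sF]; rewrite /= inE => /negPf psx; apply: IHk; rewrite -cJF.
  by apply: eq_card => t; rewrite !inE; case: (eqVneq t s) => [->|] //=; rewrite psx !andbF.
rewrite (eq_bigr (fun=> psi f)) => [|s /andP[sF sJ]].
  rewrite sumr_const => /eqP; rewrite mulrn_eq0 => /orP[|/eqP //].
  rewrite -leqn0 leqNgt => /negP[]; apply/card_gt0P; exists s0.
  by apply/andP; split; first exact: setU11.
have [->|ss0] := eqVneq s s0; first by rewrite /F setU1K.
rewrite -(psi_sym (sigma := tperm s s0) _ f); last first.
  move=> t; case: tpermP => [->|->|_ _ //]; move: sJ s0J; rewrite !inE => /eqP-> /eqP-> //.
have swap t : (t \in tperm s s0 @: f) = (tperm s s0 t \in f).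
  by rewrite -{1}[t](tpermK s s0) mem_perm_imset.
congr psi; apply/setP => t; rewrite swap.
move: sF; rewrite !inE (negPf ss0) /= => sF.
case: tpermP => [->|->|/eqP ts /eqP ts0].
- by rewrite eqxx (negPf s0f).
- by rewrite eqxx sF eq_sym ss0.
- by rewrite ts (negPf ts0).
Qed.

(** The polynomial is divisible by the power of X - x whose exponent is the number
    of slots over x, and the value at x of the quotient is proportional to the sum
    of the squares |psi f|^2 over the subsets f that contain all these slots. *)
Lemma eigenpoly_neq0 x : eigenpoly x != 0.
Proof.
apply/eqP => E0; pose J := [set s | p s == x].
have [f1 /andP[Jf1 psif1]] := exists_fibre_coordinate x.
pose rest := \sum_(f : {set 'I_n} | J \subset f)
   density f *: \prod_(s | s \notin J) ((p s)%:P - if s \in f then 'X else x%:P).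
have fac : eigenpoly x = (x%:P - 'X) ^+ #|J| * rest.
  rewrite /eigenpoly (bigID (fun f : {set 'I_n} => J \subset f)) /= addrC big1 ?add0r.
    rewrite mulr_sumr; apply: eq_bigr => f Jf; rewrite -scalerAr; congr (_ *: _).
    rewrite /slot_poly (bigID (mem J)) /= -prodr_const; congr (_ * _).
    by apply: eq_bigr => s sJ; rewrite (subsetP Jf) //; move: sJ; rewrite inE => /eqP->.
  move=> f /subsetPn[s sJ sf]; rewrite /slot_poly (bigD1 s) //= (negPf sf).
  by move: sJ; rewrite inE => /eqP->; rewrite subrr mul0r scaler0.
have X0 : (x%:P - 'X : {poly K}) != 0.
  by rewrite -oppr_eq0 opprB polyXsubC_eq0.
have r0 : rest = 0.
  by apply/eqP; move/eqP: E0; rewrite fac mulf_eq0 expf_eq0 (negPf X0) andbF.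
have : rest.[x] = (\sum_(f : {set 'I_n} | J \subset f) density f) * \prod_(s | s \notin J) (p s - x).
  rewrite horner_sum mulr_suml; apply: eq_bigr => f _.
  rewrite hornerZ horner_prod; congr (_ * _); apply: eq_bigr => s _.
  by case: (s \in f); rewrite !hornerE.
rewrite r0 horner0 => /esym/eqP; rewrite mulf_eq0 => /orP[|]; last first.
  apply/negP; rewrite prodf_seq_neq0; apply/allP => s _ /=.
  by apply/implyP; rewrite inE subr_eq0.
rewrite -mulr_suml mulf_eq0 invr_eq0 (negPf norm_neq0) orbF.
rewrite psumr_eq0 => [/allP H|f _]; last exact: sq_psi_ge0.
have := H f1 (mem_index_enum f1); rewrite Jf1 /= mulf_eq0 conjC_eq0 orbb.
by rewrite (negPf psif1).
Qed.

(** The Pluecker relation factors the eigenvalue as an alternating expression in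
    two polynomials, whose Wronskian is the restriction of the quotient by
    z - w to the diagonal. At a common root x the eigenvalue would vanish
    identically in w. *)
Lemma pencil_of_eigenvector : exists P Q : {poly K},
  [/\ (size P <= l.+2)%N, (size Q <= l.+2)%N,
      P * Q^`() - P^`() * Q = \prod_s ('X - (p s)%:P)
    & forall x, ~~ (root P x && root Q x)].
Proof.
pose M z := (z%:P - 'X) * eigenpoly z.
have ME z w : (M z).[w] = mu z w by rewrite /M !hornerE.
have sM z : (size (M z) <= l.+2)%N.
  apply: (leq_trans (size_polyMleq _ _)).
  have -> : size (z%:P - 'X : {poly K}) = 2 by rewrite -size_polyN opprB size_XsubC.
  by rewrite add2n /= ltnS size_eigenpoly.
have M0 z : M z != 0.
  by rewrite mulf_neq0 ?eigenpoly_neq0 // -oppr_eq0 opprB polyXsubC_eq0.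
have [b nb] := closed_nonrootP _ (M0 0).
pose k := mu 0 b; have k0 : k != 0 by rewrite /k -ME.
pose P := k^-1 *: M b; pose Q := M 0.
have bil z w : Q.[z] * P.[w] - Q.[w] * P.[z] = mu z w.
  rewrite /P /Q !hornerZ !ME.
  have -> : mu z w = k^-1 * (mu 0 z * mu b w - mu 0 w * mu b z).
    by rewrite -(mu_pluecker 0 b z w) addrK -/k mulKf.
  ring.
have sP : (size P <= l.+2)%N := leq_trans (size_scale_leq _ _) (sM b).
have sQ : (size Q <= l.+2)%N := sM 0.
clearbody P Q; exists P, Q; split=> //.
- apply: poly_ext => z.
  have E : Q.[z]%:P * P - Q * P.[z]%:P = M z.
    by apply: poly_ext => w; rewrite ME !hornerE bil.
  have /(congr1 (fun r : {poly K} => r^`().[z])) := E.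
  rewrite derivB !derivM !derivC derivB derivC derivX !hornerE /=.
  rewrite horner_eigenpoly_diag horner_prod => e.
  have -> : \prod_s ('X - (p s)%:P).[z] = \prod_s (p s - z).
    rewrite (eq_bigr (fun s => - (p s - z))); last by move=> s _; rewrite !hornerE opprB.
    by rewrite prodrN card_ord -signr_odd oddD addbb mul1r.
  move: e; rewrite subrr mul0r addr0 mulN1r => e.
  by rewrite -[RHS]opprK -e; ring.
- move=> x; apply/negP => /andP[/eqP Px /eqP Qx].
  have : M x = 0.
    by apply: poly_ext => w; rewrite ME -bil Px Qx mul0r mulr0 subrr horner0.
  exact/eqP/M0.
Qed.

End Pencil.

Theorem exists_pencil (K : numClosedFieldType) (l : nat) (p : 'I_(l + l) -> K) :
  (forall i : 'I_l, p (lshift l i) != p (rshift l i)) ->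
  exists P Q : {poly K},
  [/\ (size P <= l.+2)%N, (size Q <= l.+2)%N,
      P * Q^`() - P^`() * Q = \prod_s ('X - (p s)%:P)
    & forall x, ~~ (root P x && root Q x)].
Proof.
move=> /exists_eigenvector[psi [inv sym [f0 nz] eig]].
exact: pencil_of_eigenvector inv sym _ nz eig.
Qed.

(** * Changing the affine coordinate *)

Section Homogenization.
Variables (K : numClosedFieldType).
Implicit Types (P Q u v : {poly K}).

Definition homog d P u v : {poly K} := \sum_(k < d.+1) P`_k *: (u ^+ k * v ^+ (d - k)).

Definition wronskian P Q : {poly K} := P * Q^`() - P^`() * Q.

Lemma horner_homog d P u v x : (size P <= d.+1)%N -> v.[x] != 0 ->
  (homog d P u v).[x] = v.[x] ^+ d * P.[u.[x] / v.[x]].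
Proof.
move=> sP vx; rewrite (horner_coef_wide _ sP) horner_sum mulr_sumr.
apply: eq_bigr => k _; rewrite hornerZ hornerM !horner_exp expr_div_n.
rewrite [RHS]mulrCA; congr (_ * _); rewrite [RHS]mulrCA; congr (_ * _).
by rewrite expfB_cond // (negPf vx) add0n -ltnS.
Qed.

Lemma horner_homog_root d P u v x : v.[x] = 0 ->
  (homog d P u v).[x] = P`_d * u.[x] ^+ d.
Proof.
move=> vx; rewrite horner_sum big_ord_recr /= big1 ?add0r => [|k _].
  by rewrite hornerZ subnn mulr1 horner_exp.
by rewrite hornerZ hornerM !horner_exp vx expr0n subn_eq0 leqNgt ltn_ord /= !mulr0.
Qed.

(** Euler's identity for the homogeneous form of P, combined with the chain
    rule. *)
Lemma deriv_homog l P u v :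
  v * (homog l.+1 P u v)^`() = l.+1%:R * v^`() * homog l.+1 P u v
    + (u^`() * v - u * v^`()) * homog l P^`() u v.
Proof.
have -> : homog l P^`() u v =
    \sum_(k < l.+2) (P`_k *+ k) *: (u ^+ k.-1 * v ^+ (l.+1 - k)).
  rewrite big_ord_recl mulr0n scale0r add0r; apply: eq_bigr => k _.
  by rewrite coef_deriv.
rewrite /homog raddf_sum /= !mulr_sumr -big_split; apply: eq_bigr => -[k /= lk] _.
rewrite derivZ derivM !deriv_exp -!scalerAr -scalerMnl scalerMnr -scalerDr; congr (_ *: _).
move: lk; rewrite ltnS => lk.
have -> : (l.+1%:R : {poly K}) = k%:R + (l.+1 - k)%:R by rewrite -natrD subnKC.
case: k lk => [|k] lk /=.
  rewrite subn0 !mulr0n /= !expr0 exprS; ring.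
rewrite subSS exprS; case: (l - k)%N => [|m] /=; first by rewrite !mulr0n !expr0; ring.
by rewrite exprS; ring.
Qed.

(** Where v does not vanish, the form of P is v^(l+1) times the value of P at
    u / v, and the identity is the one between P and Q at this point. After
    multiplication by v it holds everywhere. *)
Lemma wronskian_homog l (p : 'I_(l + l) -> K) P Q u v :
  (size P <= l.+2)%N -> (size Q <= l.+2)%N -> v != 0 ->
  wronskian P Q = \prod_s ('X - (p s)%:P) ->
  wronskian (homog l.+1 P u v) (homog l.+1 Q u v)
  = (u^`() * v - u * v^`()) * \prod_s (u - p s *: v).
Proof.
move=> sP sQ v0 W; apply: (mulfI v0).
have sd (R : {poly K}) : (size R <= l.+2)%N -> (size R^`() <= l.+1)%N.
  move=> sR; have [->|R0] := eqVneq R 0; first by rewrite deriv0 size_poly0.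
  by rewrite -ltnS (leq_trans (lt_size_deriv R0)).
transitivity ((u^`() * v - u * v^`()) *
   (homog l.+1 P u v * homog l Q^`() u v - homog l P^`() u v * homog l.+1 Q u v)).
  rewrite /wronskian mulrBr mulrCA deriv_homog mulrA deriv_homog; ring.
rewrite mulrCA; congr (_ * _); apply: poly_ext => x.
have [vx|vx] := eqVneq v.[x] 0.
  rewrite hornerM vx mul0r hornerD hornerN !hornerM !horner_homog_root //.
  rewrite !coef_deriv exprS; ring.
rewrite hornerD hornerN !hornerM !horner_homog ?sd //.
have := congr1 (fun R : {poly K} => R.[u.[x] / v.[x]]) W.
rewrite /wronskian hornerD hornerN !hornerM !horner_prod => e.
have -> : \prod_s (u - p s *: v).[x] = v.[x] ^+ (l + l) *
    \prod_s ('X - (p s)%:P).[u.[x] / v.[x]].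
  have -> : v.[x] ^+ (l + l) = \prod_(s < l + l) v.[x] by rewrite prodr_const card_ord.
  rewrite -big_split; apply: eq_bigr => s _ /=.
  by rewrite !hornerE mulrBr mulrCA divff // mulr1 [p s * _]mulrC.
by rewrite -e exprD exprS; ring.
Qed.

(** Where v vanishes, the values are the top coefficients of P and Q; if both
    were zero, the Wronskian would have too small a degree. *)
Lemma homog_no_common_root l (p : 'I_(l + l) -> K) P Q u v x :
  (size P <= l.+2)%N -> (size Q <= l.+2)%N ->
  wronskian P Q = \prod_s ('X - (p s)%:P) ->
  (forall y, ~~ (root P y && root Q y)) ->
  (u.[x] != 0) || (v.[x] != 0) ->
  ~~ (root (homog l.+1 P u v) x && root (homog l.+1 Q u v) x).
Proof.
move=> sP sQ W nc; have [vx|vx _] := eqVneq v.[x] 0; last first.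
  apply: contra (nc (u.[x] / v.[x])); rewrite /root !horner_homog // !mulf_eq0.
  by rewrite expf_eq0 (negPf vx) andbF.
rewrite orbF => ux; rewrite /root !horner_homog_root // !mulf_eq0 expf_eq0 (negPf ux) andbF !orbF.
apply/negP => /andP[P0 Q0].
have small (R : {poly K}) : (size R <= l.+2)%N -> R`_l.+1 == 0 -> (size R <= l.+1)%N.
  move=> sR /eqP R0; apply/leq_sizeP => j; rewrite leq_eqVlt => /orP[/eqP <- //|lj].
  by apply: nth_default; apply: leq_trans sR lj.
have {}sP := small _ sP P0; have {}sQ := small _ sQ Q0.
have sd (R : {poly K}) : (size R <= l.+1)%N -> (size R^`() <= l)%N.
  move=> sR; have [->|R0] := eqVneq R 0; first by rewrite deriv0 size_poly0.
  by rewrite -ltnS (leq_trans (lt_size_deriv R0)).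
have : (size (wronskian P Q) <= l + l)%N.
  have bound i j : (i <= l.+1)%N -> (j <= l)%N -> ((i + j).-1 <= l + l)%N by lia.
  apply: (leq_trans (size_polyD _ _)); rewrite geq_max size_polyN.
  apply/andP; split; apply: (leq_trans (size_polyMleq _ _)).
    exact: bound sP (sd _ sQ).
  rewrite addnC; exact: bound sQ (sd _ sP).
by rewrite W size_prod_XsubC /= [index_enum _]unlock -enumT -cardT card_ord ltnn.
Qed.

End Homogenization.

(** A Moebius map sends a point a outside the divisor to infinity and makes all
    the points of the divisor finite. The pencil found there is pulled back in
    homogeneous form, through (u, v) = (1, X - a) in the coordinate z and
    through (u, v) = (X, 1 - a X) in the coordinate w = 1 / z. *)
Theorem exists_sphere_pencil (K : numClosedFieldType) (l : nat)
    (q : 'I_(l + l) -> option K) :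
  (forall i : 'I_l, q (lshift l i) != q (rshift l i)) ->
  exists (P Q P' Q' : {poly K}) (c c' : K),
  [/\ forall w, w != 0 -> P'.[w] = w ^+ l.+1 * P.[w^-1] /\ Q'.[w] = w ^+ l.+1 * Q.[w^-1],
      forall w, w != 0 ->
        (wronskian P' Q').[w] = - (w ^+ (l + l) * (wronskian P Q).[w^-1]),
      (forall x, ~~ (root P x && root Q x)) /\
      (forall x, ~~ (root P' x && root Q' x)),
      c != 0 /\ wronskian P Q = c *: \prod_s (if q s is Some x then 'X - x%:P else 1)
    & c' != 0 /\ wronskian P' Q' = c' *: \prod_s (if q s is Some x then x *: 'X - 1 else 'X)].
Proof.
move=> q_apart.
have [a aq] : exists a, forall s, q s != Some a.
  have nz : \prod_s ('X - (odflt 0 (q s))%:P) != 0.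
    by rewrite prodf_seq_neq0; apply/allP => s _; rewrite /= polyXsubC_eq0.
  have [a na] := closed_nonrootP _ nz; exists a => s.
  apply: contra na => /eqP qa; rewrite /root horner_prod (bigD1 s) //= qa /=.
  by rewrite !hornerE subrr mul0r.
pose p s : K := if q s is Some x then (x - a)^-1 else 0.
have xa s x : q s = Some x -> x - a != 0.
  by move=> qs; apply: contra (aq s); rewrite subr_eq0 qs => /eqP->.
have p_apart i : p (lshift l i) != p (rshift l i).
  apply: contra (q_apart i); rewrite /p.
  case E1: (q (lshift l i)) => [x|]; case E2: (q (rshift l i)) => [y|] //.
  - by rewrite (inj_eq (@invr_inj _)) (inj_eq (addIr _)) => /eqP->.
  - by rewrite invr_eq0 (negPf (xa _ _ E1)).
  - by rewrite eq_sym invr_eq0 (negPf (xa _ _ E2)).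
have [P0 [Q0 [sP sQ W nc]]] := exists_pencil p_apart.
pose k (e : K) s : K := if q s is Some x then e / (x - a) else 1.
have k0 e : e != 0 -> \prod_s k e s != 0.
  move=> e0; rewrite prodf_seq_neq0; apply/allP => s _; rewrite /= /k.
  by case E: (q s) => [x|]; rewrite ?oner_eq0 // mulf_neq0 // invr_eq0 (xa _ _ E).
pose v : {poly K} := 'X - a%:P; pose v' : {poly K} := 1 - a *: 'X.
have v0 : v != 0 by rewrite polyXsubC_eq0.
have v'0 : v' != 0.
  apply/eqP => /(congr1 (fun r : {poly K} => r.[0])) /eqP.
  by rewrite hornerD hornerN hornerZ hornerX hornerC horner0 mulr0 subr0 oner_eq0.
have Wv : wronskian (homog l.+1 P0 1 v) (homog l.+1 Q0 1 v) = - \prod_s (1 - p s *: v).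
  by rewrite (wronskian_homog 1 sP sQ v0 W) derivC derivXsubC mul0r mul1r sub0r mulN1r.
have Wv' : wronskian (homog l.+1 P0 'X v') (homog l.+1 Q0 'X v') = \prod_s ('X - p s *: v').
  rewrite (wronskian_homog 'X sP sQ v'0 W).
  have -> : ('X)^`() * v' - 'X * v'^`() = 1.
    rewrite derivX /v' derivB derivC derivZ derivX.
    by rewrite -!mul_polyC; ring.
  by rewrite mul1r.
exists (homog l.+1 P0 1 v), (homog l.+1 Q0 1 v), (homog l.+1 P0 'X v'), (homog l.+1 Q0 'X v').
exists (- \prod_s k (-1) s), (\prod_s k 1 s); split.
- move=> w w0; have inv R : (homog l.+1 R 'X v').[w] = w ^+ l.+1 * (homog l.+1 R 1 v).[w^-1].
    rewrite !horner_sum mulr_sumr; apply: eq_bigr => -[j /= lj] _.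
    rewrite !hornerZ mulrCA; congr (_ * _); rewrite !hornerM !horner_exp hornerX.
    rewrite hornerC expr1n mul1r -{2}(subnKC (m := j) (n := l.+1)) //.
    rewrite exprD -mulrA; congr (_ * _); rewrite -exprMn; congr (_ ^+ _).
    by rewrite /v /v' !hornerE mulrBr divff // [a * w]mulrC.
  by split; apply: inv.
- move=> w w0; rewrite Wv Wv' hornerN !horner_prod mulrN opprK.
  have -> : w ^+ (l + l) = \prod_(s < l + l) w by rewrite prodr_const card_ord.
  rewrite -big_split; apply: eq_bigr => s _ /=.
  rewrite /v /v' !(hornerD, hornerN, hornerZ, hornerX, hornerC).
  by field.
- split=> x; apply: (homog_no_common_root sP sQ W nc).
    by rewrite hornerC oner_eq0.
  rewrite hornerX; have [->|//] := eqVneq x 0.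
  by rewrite /v' hornerD hornerN hornerZ hornerX hornerC mulr0 subr0 oner_eq0.
- split; first by rewrite oppr_eq0 k0 // oppr_eq0 oner_eq0.
  rewrite Wv scaleNr; congr (- _); rewrite -scaler_prod; apply: eq_bigr => s _.
  rewrite /p /k; case E: (q s) => [x|]; last by rewrite scale0r subr0 scale1r.
  have e : (x - a)^-1 * (x - a) = 1 := mulVf (xa _ _ E).
  have -> : (1 : {poly K}) = ((x - a)^-1 * (x - a))%:P by rewrite e.
  rewrite -!mul_polyC /v mulN1r polyCN polyCM polyCB; ring.
- split; first by rewrite k0 // oner_eq0.
  rewrite Wv' -scaler_prod; apply: eq_bigr => s _.
  rewrite /p /k; case E: (q s) => [x|]; last by rewrite scale0r subr0 scale1r.
  have e : (x - a)^-1 * (x - a) = 1 := mulVf (xa _ _ E).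
  have eX : ('X : {poly K}) = ((x - a)^-1 * (x - a)) *: 'X by rewrite e scale1r.
  rewrite [X in X - _ = _]eX /v' -!mul_polyC mul1r polyCM polyCB; ring.
Qed.

End RationalPencils.

Open Scope R_scope.

(** * Divisors on the sphere *)

Definition local_factor (k : chart) (q : sphere) (z : C) : C :=
  match k, q with
  | Zchart, Some x => (z - x)%C
  | Zchart, None => 1%C
  | Wchart, Some x => (x * z - 1)%C
  | Wchart, None => z
  end.

Fixpoint divisor_poly (k : chart) (p : list sphere) (m : list nat) (z : C) : C :=
  match p, m with
  | q :: p', e :: m' => (local_factor k q z ^ e * divisor_poly k p' m' z)%C
  | _, _ => 1%C
  end.

(** * Smooth functions on the plane *)

Definition has_partial (i : axis) (f f' : C -> R) : Prop :=
  forall p, is_derive (slice i f p) (coord p i) (f' p).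

Lemma slice_at i f p : slice i f p (coord p i) = f p.
Proof. destruct i, p; reflexivity. Qed.

Lemma has_partial_eq i f f' : has_partial i f f' -> partial i f = f'.
Proof.
  intros H; apply functional_extensionality; intros p.
  apply is_derive_unique, H.
Qed.

Lemma has_partial_intro i f :
  (forall p, ex_derive (slice i f p) (coord p i)) -> has_partial i f (partial i f).
Proof. intros H p; apply Derive_correct, H. Qed.

Lemma has_partial_const i c : has_partial i (fun _ => c) (fun _ => 0).
Proof.
  intros p; destruct i; apply (is_derive_const (K := R_AbsRing) (V := R_NormedModule) c).
Qed.

Lemma has_partial_plus i f g f' g' : has_partial i f f' -> has_partial i g g' ->
  has_partial i (fun p => f p + g p) (fun p => f' p + g' p).
Proof.
  intros Hf Hg p; specialize (Hf p); specialize (Hg p).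
  destruct i; apply (is_derive_plus (K := R_AbsRing) (V := R_NormedModule) _ _ _ _ _ Hf Hg).
Qed.

Lemma has_partial_mult i f g f' g' : has_partial i f f' -> has_partial i g g' ->
  has_partial i (fun p => f p * g p) (fun p => f' p * g p + f p * g' p).
Proof.
  intros Hf Hg p; specialize (Hf p); specialize (Hg p).
  rewrite <- (slice_at i f p), <- (slice_at i g p).
  destruct i; apply (is_derive_mult (K := R_AbsRing) _ _ _ _ _ Hf Hg); intros; apply Rmult_comm.
Qed.

Lemma is_derive_Rpower_l x s : 0 < x ->
  is_derive (fun t => Rpower t s) x (Rpower x (s - 1) * s).
Proof.
  intros Hx.
  replace (Rpower x (s - 1) * s) with (s * / x * Rpower x s).
  - unfold Rpower; auto_derive; [exact Hx | ring].
  - unfold Rminus; rewrite Rpower_plus, Rpower_Ropp, Rpower_1; [ring | exact Hx].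
Qed.

Lemma has_partial_Rpower i f f' s : (forall p, 0 < f p) -> has_partial i f f' ->
  has_partial i (fun p => Rpower (f p) s) (fun p => Rpower (f p) (s - 1) * (s * f' p)).
Proof.
  intros Hpos Hf p; specialize (Hf p).
  replace (Rpower (f p) (s - 1) * (s * f' p))
    with (f' p * (Rpower (f p) (s - 1) * s)) by ring.
  assert (H := is_derive_Rpower_l (f p) s (Hpos p)).
  rewrite <- (slice_at i f p) in H |- *.
  destruct i; apply (is_derive_comp (fun t => Rpower t s) (slice _ f p) _ _ _ H Hf).
Qed.

Lemma has_partial_ext i f f' g' : has_partial i f f' -> (forall p, f' p = g' p) ->
  has_partial i f g'.
Proof. intros H e p; rewrite <- e; apply H. Qed.

Definition everywhere (_ : C) : Prop := True.

Notation Ck n f := (class_Ck n everywhere f).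

Lemma Ck_continuous n f : Ck n f -> forall p, continuous f p.
Proof. destruct n; intros [H _] p; apply H; exact I. Qed.

Lemma Ck_S n f : (forall p, continuous f p) ->
  (forall i, exists f', has_partial i f f' /\ Ck n f') -> Ck (S n) f.
Proof.
  intros Hc Hd; split; [intros p _; apply Hc |].
  intros i; destruct (Hd i) as [f' [H H']]; split.
  - intros p _; exists (f' p); apply H.
  - now rewrite (has_partial_eq _ _ _ H).
Qed.

Lemma Ck_S_partial n f i : Ck (S n) f -> has_partial i f (partial i f) /\ Ck n (partial i f).
Proof.
  intros [_ H]; destruct (H i) as [H1 H2]; split; [| exact H2].
  apply has_partial_intro; intros p; apply H1; exact I.
Qed.

Lemma Ck_pred n f : Ck (S n) f -> Ck n f.
Proof.
  revert f; induction n as [|n IH]; intros f H.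
  - split; [apply H | exact I].
  - apply Ck_S; [apply (Ck_continuous _ _ H) |].
    intros i; exists (partial i f); destruct (Ck_S_partial _ _ i H); auto.
Qed.

Lemma Ck_const n c : Ck n (fun _ => c).
Proof.
  revert c; induction n as [|n IH]; intros c.
  - split; [intros p _; apply continuous_const | exact I].
  - apply Ck_S; [intros p; apply continuous_const |].
    intros i; exists (fun _ => 0); split; [apply has_partial_const | apply IH].
Qed.

Lemma has_partial_coord i j :
  has_partial i (fun p => coord p j)
    (fun _ => match i, j with X, X | Y, Y => 1 | _, _ => 0 end).
Proof.
  intros [x y]; destruct i, j; simpl;
    apply is_derive_Reals, derivable_pt_lim_id || apply (is_derive_const (K := R_AbsRing) (V := R_NormedModule)).
Qed.

Lemma continuous_coord j (p : C) : continuous (fun p : C => coord p j) p.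
Proof.
  destruct p as [x y]; destruct j; simpl.
  - apply (continuous_fst (U := R_UniformSpace) (V := R_UniformSpace) x y).
  - apply (continuous_snd (U := R_UniformSpace) (V := R_UniformSpace) x y).
Qed.

Lemma Ck_coord n j : Ck n (fun p => coord p j).
Proof.
  destruct n as [|n].
  - split; [intros p _; apply continuous_coord | exact I].
  - apply Ck_S; [intros p; apply continuous_coord |].
    intros i; eexists; split; [apply has_partial_coord | apply Ck_const].
Qed.

Lemma Ck_plus n f g : Ck n f -> Ck n g -> Ck n (fun p => f p + g p).
Proof.
  revert f g; induction n as [|n IH]; intros f g Hf Hg.
  - split; [|exact I]; intros p _.
    apply (continuous_plus (V := R_NormedModule)); apply (Ck_continuous 0); assumption.
  - apply Ck_S.
    + intros p; apply (continuous_plus (V := R_NormedModule)); eapply Ck_continuous; eassumption.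
    + intros i; destruct (Ck_S_partial _ _ i Hf), (Ck_S_partial _ _ i Hg).
      eexists; split; [apply has_partial_plus; eassumption | apply IH; assumption].
Qed.

Lemma Ck_mult n f g : Ck n f -> Ck n g -> Ck n (fun p => f p * g p).
Proof.
  revert f g; induction n as [|n IH]; intros f g Hf Hg.
  - split; [|exact I]; intros p _.
    apply (continuous_mult (K := R_AbsRing)); apply (Ck_continuous 0); assumption.
  - apply Ck_S.
    + intros p; apply (continuous_mult (K := R_AbsRing)); eapply Ck_continuous; eassumption.
    + intros i; destruct (Ck_S_partial _ _ i Hf), (Ck_S_partial _ _ i Hg).
      eexists; split; [apply has_partial_mult; eassumption |].
      apply Ck_plus; apply IH; auto using Ck_pred.
Qed.

Lemma continuous_Rpower f s p : (forall p, 0 < f p) -> continuous f p ->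
  continuous (fun p : C => Rpower (f p) s) p.
Proof.
  intros Hpos Hc; apply (continuous_comp f (fun t => Rpower t s)); [exact Hc |].
  apply (ex_derive_continuous (K := R_AbsRing) (V := R_NormedModule)).
  eexists; apply is_derive_Rpower_l, Hpos.
Qed.

Lemma Ck_Rpower n f s : (forall p, 0 < f p) -> Ck n f -> Ck n (fun p => Rpower (f p) s).
Proof.
  intros Hpos; revert s; induction n as [|n IH]; intros s Hf.
  - split; [|exact I]; intros p _; apply continuous_Rpower; [exact Hpos |].
    apply (Ck_continuous 0); exact Hf.
  - apply Ck_S.
    + intros p; apply continuous_Rpower; [exact Hpos | eapply Ck_continuous, Hf].
    + intros i; destruct (Ck_S_partial _ _ i Hf) as [H1 H2].
      eexists; split; [apply has_partial_Rpower; eassumption |].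
      apply Ck_mult; [apply IH, Ck_pred, Hf |].
      apply Ck_mult; [apply Ck_const | exact H2].
Qed.

(** * Complex polynomials as functions of two real variables *)

Fixpoint peval (a : list C) (z : C) : C :=
  match a with nil => 0%C | c :: a' => (c + z * peval a' z)%C end.

Fixpoint padd (a b : list C) : list C :=
  match a, b with
  | nil, _ => b
  | _, nil => a
  | c :: a', d :: b' => (c + d)%C :: padd a' b'
  end.

Fixpoint pderive (a : list C) : list C :=
  match a with nil => nil | _ :: a' => padd a' (RtoC 0 :: pderive a') end.

Lemma peval_padd a b z : peval (padd a b) z = (peval a z + peval b z)%C.
Proof.
  revert b; induction a as [|c a IH]; intros [|d b]; simpl; try ring.
  rewrite IH; ring.
Qed.

Lemma peval_pderive_cons c a z :
  peval (pderive (c :: a)) z = (peval a z + z * peval (pderive a) z)%C.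
Proof. simpl; rewrite peval_padd; simpl; ring. Qed.

Definition re_poly a (p : C) : R := fst (peval a p).
Definition im_poly a (p : C) : R := snd (peval a p).

Lemma re_poly_cons c a p :
  re_poly (c :: a) p = fst c + (coord p X * re_poly a p + (-1) * (coord p Y * im_poly a p)).
Proof. unfold re_poly, im_poly; simpl; ring. Qed.

Lemma im_poly_cons c a p :
  im_poly (c :: a) p = snd c + (coord p X * im_poly a p + coord p Y * re_poly a p).
Proof. unfold re_poly, im_poly; simpl; ring. Qed.

Lemma Ck_poly n a : Ck n (re_poly a) /\ Ck n (im_poly a).
Proof.
  induction a as [|c a [IHr IHi]].
  - split; apply (Ck_const n 0).
  - split.
    + rewrite (functional_extensionality _ _ (re_poly_cons c a)).
      apply Ck_plus; [apply Ck_const |].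
      apply Ck_plus; [| apply Ck_mult; [apply Ck_const |]];
        (apply Ck_mult; [apply Ck_coord | assumption]).
    + rewrite (functional_extensionality _ _ (im_poly_cons c a)).
      apply Ck_plus; [apply Ck_const |].
      apply Ck_plus; (apply Ck_mult; [apply Ck_coord | assumption]).
Qed.

Ltac partials :=
  lazymatch goal with
  | |- has_partial _ (fun p => @?f p + @?g p) _ => apply has_partial_plus; partials
  | |- has_partial _ (fun p => @?f p * @?g p) _ => apply has_partial_mult; partials
  | |- has_partial _ (fun p => coord p _) _ => apply has_partial_coord
  | |- has_partial _ (fun _ => ?c) _ => apply has_partial_const
  | _ => eassumption
  end.

Lemma has_partial_poly a :
  has_partial X (re_poly a) (re_poly (pderive a)) /\
  has_partial X (im_poly a) (im_poly (pderive a)) /\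
  has_partial Y (re_poly a) (fun p => - im_poly (pderive a) p) /\
  has_partial Y (im_poly a) (re_poly (pderive a)).
Proof.
  induction a as [|c a (IH1 & IH2 & IH3 & IH4)].
  - refine (conj _ (conj _ (conj _ _)));
      (eapply has_partial_ext; [apply (has_partial_const _ 0) |]);
      intros p; unfold re_poly, im_poly; simpl; ring.
  - rewrite (functional_extensionality _ _ (re_poly_cons c a)).
    rewrite (functional_extensionality _ _ (im_poly_cons c a)).
    assert (E : forall p, peval (pderive (c :: a)) p
                          = (peval a p + p * peval (pderive a) p)%C)
      by apply peval_pderive_cons.
    refine (conj _ (conj _ (conj _ _)));
      (eapply has_partial_ext;
       [ partials
       | intros p; unfold re_poly, im_poly; rewrite E; simpl; ring ]).
Qed.

Definition norm2 (z : C) : R := fst z * fst z + snd z * snd z.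

Lemma norm2_mult (z w : C) : norm2 (z * w)%C = norm2 z * norm2 w.
Proof. unfold norm2; simpl; ring. Qed.

Lemma norm2_ge0 (z : C) : 0 <= norm2 z.
Proof. unfold norm2; nra. Qed.

Lemma norm2_eq0 (z : C) : norm2 z = 0 -> z = 0%C.
Proof.
  unfold norm2; destruct z as [x y]; simpl; intros H.
  apply injective_projections; simpl; nra.
Qed.

Lemma norm2_pos (z : C) : z <> 0%C -> 0 < norm2 z.
Proof.
  intros H; destruct (norm2_ge0 z) as [h|h]; [exact h |].
  now elim H; apply norm2_eq0.
Qed.

Lemma norm2_pow (z : C) n : norm2 (z ^ n)%C = norm2 z ^ n.
Proof.
  induction n as [|n IH]; [unfold norm2; simpl; ring |].
  now rewrite Cpow_S, norm2_mult, IH.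
Qed.

Lemma norm2_inv (z : C) : z <> 0%C -> norm2 (/ z)%C = / norm2 z.
Proof.
  intros H; assert (h := norm2_pos z H).
  assert (E : norm2 (/ z)%C * norm2 z = 1).
  { rewrite <- norm2_mult, Cinv_l; [unfold norm2; simpl; ring | exact H]. }
  apply (Rmult_eq_reg_r (norm2 z)); [rewrite E; field |]; lra.
Qed.

Lemma Cmod_norm2 (z : C) : Cmod z = sqrt (norm2 z).
Proof. unfold Cmod, norm2; f_equal; ring. Qed.

Definition sq_poly a (p : C) : R := norm2 (peval a p).

Definition sq_poly_1 i a (p : C) : R :=
  let f := peval a p in let f' := peval (pderive a) p in
  match i with
  | X => 2 * (fst f * fst f' + snd f * snd f')
  | Y => 2 * (snd f * fst f' - fst f * snd f')
  end.

Definition sq_poly_2 i a (p : C) : R :=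
  let f := peval a p in let f' := peval (pderive a) p in
  let f'' := peval (pderive (pderive a)) p in
  match i with
  | X => 2 * (norm2 f' + fst f * fst f'' + snd f * snd f'')
  | Y => 2 * (norm2 f' - fst f * fst f'' - snd f * snd f'')
  end.

Lemma sq_poly_ext a p : sq_poly a p = re_poly a p * re_poly a p + im_poly a p * im_poly a p.
Proof. reflexivity. Qed.

Lemma Ck_sq_poly n a : Ck n (sq_poly a).
Proof.
  rewrite (functional_extensionality _ _ (sq_poly_ext a)).
  destruct (Ck_poly n a); apply Ck_plus; apply Ck_mult; assumption.
Qed.

Lemma has_partial_sq_poly i a : has_partial i (sq_poly a) (sq_poly_1 i a).
Proof.
  rewrite (functional_extensionality _ _ (sq_poly_ext a)).
  destruct (has_partial_poly a) as (H1 & H2 & H3 & H4).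
  destruct i; (eapply has_partial_ext; [partials |]);
    intros p; unfold sq_poly_1, re_poly, im_poly; simpl; ring.
Qed.

Lemma has_partial_sq_poly_1 i a : has_partial i (sq_poly_1 i a) (sq_poly_2 i a).
Proof.
  destruct (has_partial_poly a) as (H1 & H2 & H3 & H4).
  destruct (has_partial_poly (pderive a)) as (D1 & D2 & D3 & D4).
  destruct i.
  - assert (E : forall p, sq_poly_1 X a p = 2 * (re_poly a p * re_poly (pderive a) p
      + im_poly a p * im_poly (pderive a) p)) by reflexivity.
    rewrite (functional_extensionality _ _ E).
    eapply has_partial_ext; [partials |].
    intros p; unfold sq_poly_2, re_poly, im_poly, norm2; simpl; ring.
  - assert (E : forall p, sq_poly_1 Y a p = 2 * (im_poly a p * re_poly (pderive a) p
      + (-1) * (re_poly a p * im_poly (pderive a) p)))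
      by (intros p; unfold sq_poly_1, re_poly, im_poly; simpl; ring).
    rewrite (functional_extensionality _ _ E).
    eapply has_partial_ext; [partials |].
    intros p; unfold sq_poly_2, re_poly, im_poly, norm2; simpl; ring.
Qed.

(** * Conformal metrics on the plane *)

Definition conformal_tensor (E : C -> R) : tensor :=
  fun i j => match i, j with X, X | Y, Y => E | _, _ => fun _ => 0 end.

Lemma inner_conformal E p u v :
  inner (conformal_tensor E) p u v = E p * (fst u * fst v + snd u * snd v).
Proof. unfold inner, sum_axis, conformal_tensor, coord; ring. Qed.

Lemma riemannian_conformal E : (forall p, 0 < E p) -> (forall n, Ck n E) ->
  riemannian (conformal_tensor E).
Proof.
  intros Hpos HE; split.
  - intros i j n; destruct i, j; simpl; auto using Ck_const.
  - intros i j p; destruct i, j; reflexivity.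
  - intros p v Hv; rewrite inner_conformal.
    apply Rmult_lt_0_compat; [apply Hpos | apply (norm2_pos v Hv)].
Qed.

Section ConformalCurvature.
Variables (E : C -> R) (phi phi' : axis -> C -> R).
Hypothesis E_pos : forall p, 0 < E p.
(* [phi i] is half of the i-th derivative of [ln E]. *)
Hypothesis E_partial : forall i, has_partial i E (fun p => 2 * phi i p * E p).
Hypothesis phi_partial : forall i, has_partial i (phi i) (phi' i).
Let g := conformal_tensor E.

Lemma partial_conformal i j k : partial i (g j k) =
  match j, k with X, X | Y, Y => fun p => 2 * phi i p * E p | _, _ => fun _ => 0 end.
Proof.
  destruct j, k; apply has_partial_eq; simpl; auto using has_partial_const.
Qed.

Lemma christoffel_conformal k i j : christoffel g k i j =
  match k, i, j with
  | X, X, X => phi X | X, Y, Y => fun p => -1 * phi X p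
  | Y, Y, Y => phi Y | Y, X, X => fun p => -1 * phi Y p
  | X, _, _ => phi Y | Y, _, _ => phi X
  end.
Proof.
  apply functional_extensionality; intros p; assert (h := E_pos p).
  unfold christoffel, sum_axis; rewrite !partial_conformal.
  unfold ginv, gdet, g, conformal_tensor; destruct k, i, j; field; lra.
Qed.

(** All the quadratic terms in the Christoffel symbols cancel. *)
Lemma gauss_curvature_conformal p :
  gauss_curvature g p = - (phi' X p + phi' Y p) / E p.
Proof.
  assert (h := E_pos p).
  unfold gauss_curvature, sum_axis, riemann, sum_axis; rewrite !christoffel_conformal.
  rewrite (has_partial_eq Y (phi Y) _ (phi_partial Y)).
  rewrite (has_partial_eq X (fun q => -1 * phi X q) (fun q => -1 * phi' X q)).
  2:{ eapply has_partial_ext; [apply has_partial_mult;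
        [apply has_partial_const | apply phi_partial] | intros q; simpl; ring]. }
  unfold gdet, g, conformal_tensor; field; lra.
Qed.

Lemma laplacian_conformal f f' f'' p :
  (forall i, has_partial i f (f' i)) -> (forall i, has_partial i (f' i) (f'' i)) ->
  laplacian g f p = (f'' X p + f'' Y p) / E p.
Proof.
  intros H1 H2; assert (h := E_pos p).
  assert (F : forall i, (fun q => sqrt (gdet g q) * grad g f i q) = f' i).
  { intros i; apply functional_extensionality; intros q; assert (h' := E_pos q).
    replace (gdet g q) with (E q * E q)
      by (unfold gdet, g, conformal_tensor; ring).
    rewrite sqrt_square by lra.
    unfold grad, sum_axis; rewrite !(has_partial_eq _ _ _ (H1 _)).
    unfold ginv, gdet, g, conformal_tensor; destruct i; field; lra. }
  unfold laplacian, divergence, sum_axis; rewrite !F.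
  rewrite !(has_partial_eq _ _ _ (H2 _)).
  replace (gdet g p) with (E p * E p) by (unfold gdet, g, conformal_tensor; ring).
  rewrite sqrt_square by lra; reflexivity.
Qed.

Lemma grad_norm2_conformal f f' p : (forall i, has_partial i f (f' i)) ->
  grad_norm2 g f p = (f' X p * f' X p + f' Y p * f' Y p) / E p.
Proof.
  intros H1; assert (h := E_pos p); unfold grad_norm2, g.
  rewrite inner_conformal; unfold grad, sum_axis; rewrite !(has_partial_eq _ _ _ (H1 _)).
  unfold ginv, gdet, conformal_tensor; simpl; field; lra.
Qed.

End ConformalCurvature.

(** * The metric of a pencil of polynomials *)

Section PencilMetric.
Variables (l : nat) (P Q W : list C).
Hypothesis no_common_zero : forall z : C, ~ (peval P z = 0%C /\ peval Q z = 0%C).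
Hypothesis wronskian_PQ : forall z,
  (peval P z * peval (pderive Q) z - peval (pderive P) z * peval Q z)%C = peval W z.

Let d := INR (S l).

Definition pencil_norm (p : C) : R := sq_poly P p + sq_poly Q p.
Let G := pencil_norm.
Let G1 i p := sq_poly_1 i P p + sq_poly_1 i Q p.
Let G2 i p := sq_poly_2 i P p + sq_poly_2 i Q p.
Let B := sq_poly W.

Definition pencil_factor (p : C) : R := Rpower (pencil_norm p) (- 2 / d).
Let E := pencil_factor.

Definition pencil_metric : tensor := conformal_tensor pencil_factor.

Definition pencil_curvature (p : C) : R :=
  4 / d * (sq_poly W p * Rpower (pencil_norm p) (2 / d - 2)).

Let d_pos : 0 < d.
Proof. apply lt_0_INR; lia. Qed.

Lemma pencil_norm_pos p : 0 < G p.
Proof.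
  unfold G, pencil_norm, sq_poly.
  assert (h1 := norm2_ge0 (peval P p)); assert (h2 := norm2_ge0 (peval Q p)).
  destruct (Req_dec (norm2 (peval P p)) 0) as [e1|n1]; [|lra].
  destruct (Req_dec (norm2 (peval Q p)) 0) as [e2|n2]; [|lra].
  elim (no_common_zero p); split; now apply norm2_eq0.
Qed.

Let E_pos p : 0 < E p.
Proof. apply exp_pos. Qed.

Let Ck_G n : Ck n G.
Proof. apply Ck_plus; apply Ck_sq_poly. Qed.

Lemma pencil_metric_riemannian : riemannian pencil_metric.
Proof.
  apply riemannian_conformal; [exact E_pos |].
  intros n; apply Ck_Rpower; [exact pencil_norm_pos | apply Ck_G].
Qed.

Let G_partial i : has_partial i G (G1 i).
Proof. apply has_partial_plus; apply has_partial_sq_poly. Qed.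

Let G1_partial i : has_partial i (G1 i) (G2 i).
Proof. apply has_partial_plus; apply has_partial_sq_poly_1. Qed.

(** Lagrange's identity: four times the squared modulus of the Wronskian is
    the numerator of the Laplacian of the logarithm of the norm. *)
Let lagrange p : G p * (G2 X p + G2 Y p) = G1 X p * G1 X p + G1 Y p * G1 Y p + 4 * B p.
Proof.
  unfold G, pencil_norm, G1, G2, B, sq_poly, sq_poly_1, sq_poly_2.
  rewrite <- wronskian_PQ; unfold norm2; simpl; ring.
Qed.

Let log_harmonic p : B p * (sq_poly_2 X W p + sq_poly_2 Y W p)
  = sq_poly_1 X W p * sq_poly_1 X W p + sq_poly_1 Y W p * sq_poly_1 Y W p.
Proof. unfold B, sq_poly, sq_poly_1, sq_poly_2, norm2; simpl; ring. Qed.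

Let Rpower_m1 p : Rpower (G p) (- (1)) = / G p.
Proof. rewrite Rpower_Ropp, Rpower_1; [reflexivity | apply pencil_norm_pos]. Qed.

Let Rpower_m2 p : Rpower (G p) (- (1) - 1) = / G p * / G p.
Proof. unfold Rminus; rewrite Rpower_plus, Rpower_m1; reflexivity. Qed.

Let Rpower_weight p : Rpower (G p) (2 / d - 2) = / E p * (/ G p * / G p).
Proof.
  replace (2 / d - 2) with (- (- 2 / d) + (- (1) - 1)) by (field; lra).
  rewrite Rpower_plus, Rpower_m2, Rpower_Ropp; reflexivity.
Qed.

(** For the conformal factor E the curvature is minus the Laplacian of ln E over
    2 E, and ln E is a multiple of the logarithm of the norm. *)
Lemma gauss_curvature_pencil : gauss_curvature pencil_metric = pencil_curvature.
Proof.
  apply functional_extensionality; intros p.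
  pose (phi i q := - 1 / d * (G1 i q * Rpower (G q) (- (1)))).
  pose (phi' i q := - 1 / d * (G2 i q * Rpower (G q) (- (1))
     + G1 i q * (Rpower (G q) (- (1) - 1) * (- (1) * G1 i q)))).
  assert (h := pencil_norm_pos p).
  unfold pencil_metric; rewrite (gauss_curvature_conformal E phi phi').
  - unfold phi', pencil_curvature; fold (G p); rewrite Rpower_weight, Rpower_m1, Rpower_m2.
    assert (L := lagrange p); assert (hE := E_pos p).
    replace (sq_poly W p) with
      ((G p * (G2 X p + G2 Y p) - G1 X p * G1 X p - G1 Y p * G1 Y p) / 4)
      by (rewrite L; unfold B; field).
    field; lra.
  - exact E_pos.
  - intros i; eapply has_partial_ext.
    + apply has_partial_Rpower; [exact pencil_norm_pos | apply G_partial].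
    + intros q; unfold phi, E, pencil_factor; fold (G q); rewrite Rpower_m1.
      unfold Rminus; rewrite Rpower_plus, Rpower_m1; field.
      assert (h' := pencil_norm_pos q); lra.
  - intros i; eapply has_partial_ext.
    + unfold phi; apply has_partial_mult; [apply has_partial_const |].
      apply has_partial_mult; [apply G1_partial |].
      apply has_partial_Rpower; [exact pencil_norm_pos | apply G_partial].
    + intros q; unfold phi'; simpl; ring.
Qed.

(** For a product of two functions B and M, the expression f lap f - |grad f|^2 is
    B^2 times that of M plus M^2 times that of B. The squared modulus of the
    Wronskian contributes nothing, as its logarithm is harmonic, and the power
    of the norm contributes the cube of the curvature by Lagrange's identity. *)
Lemma pencil_ricci p : ricci_equation (- 2 * INR l) 0 0 pencil_metric p.
Proof.
  unfold ricci_equation; rewrite gauss_curvature_pencil.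
  pose (s := 2 / d - 2).
  pose (K1 i q := 4 / d * (sq_poly_1 i W q * Rpower (G q) s
      + sq_poly W q * (Rpower (G q) (s - 1) * (s * G1 i q)))).
  pose (K2 i q := 4 / d * (sq_poly_2 i W q * Rpower (G q) s
      + 2 * (sq_poly_1 i W q * (Rpower (G q) (s - 1) * (s * G1 i q)))
      + sq_poly W q * (Rpower (G q) (s - 1 - 1) * ((s - 1) * G1 i q) * (s * G1 i q)
                       + Rpower (G q) (s - 1) * (s * G2 i q)))).
  assert (D1 : forall i, has_partial i pencil_curvature (K1 i)).
  { intros i; eapply has_partial_ext.
    - apply has_partial_mult; [apply has_partial_const |].
      apply has_partial_mult; [apply has_partial_sq_poly |].
      apply has_partial_Rpower; [exact pencil_norm_pos | apply G_partial].
    - intros q; unfold K1, s, G; simpl; ring. }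
  assert (D2 : forall i, has_partial i (K1 i) (K2 i)).
  { intros i; unfold K1; eapply has_partial_ext.
    - apply has_partial_mult; [apply has_partial_const |].
      apply has_partial_plus; apply has_partial_mult.
      + apply has_partial_sq_poly_1.
      + apply has_partial_Rpower; [exact pencil_norm_pos | apply G_partial].
      + apply has_partial_sq_poly.
      + apply has_partial_mult.
        * apply has_partial_Rpower; [exact pencil_norm_pos | apply G_partial].
        * apply has_partial_mult; [apply has_partial_const | apply G1_partial].
    - intros q; unfold K2; simpl; ring. }
  cbv zeta; change pencil_metric with (conformal_tensor E).
  rewrite (laplacian_conformal E E_pos pencil_curvature K1 K2 p D1 D2).
  rewrite (grad_norm2_conformal E E_pos pencil_curvature K1 p D1).
  assert (h := pencil_norm_pos p); assert (hE := E_pos p).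
  assert (L := lagrange p); assert (H := log_harmonic p).
  unfold K1, K2, pencil_curvature; fold (G p); fold s.
  assert (M1 : Rpower (G p) (s - 1) = Rpower (G p) s * / G p).
  { unfold Rminus; rewrite Rpower_plus, Rpower_m1; reflexivity. }
  assert (M2 : Rpower (G p) (s - 1 - 1) = Rpower (G p) s * / G p * / G p).
  { unfold Rminus; rewrite !Rpower_plus, !Rpower_m1; reflexivity. }
  rewrite M1, M2; unfold s; rewrite Rpower_weight.
  assert (dl : INR l = d - 1) by (unfold d; rewrite S_INR; lra).
  rewrite dl.
  fold (B p); fold (B p) in L, H.
  set (m := 4 / d * (/ E p * (/ G p * / G p))).
  transitivity
    (- (m * m / E p) * (B p * (sq_poly_2 X W p + sq_poly_2 Y W p)
          - (sq_poly_1 X W p * sq_poly_1 X W p + sq_poly_1 Y W p * sq_poly_1 Y W p))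
     - m * m / E p * (B p * B p * s * (/ G p * / G p)) *
       (G p * (G2 X p + G2 Y p)
          - (G1 X p * G1 X p + G1 Y p * G1 Y p + 4 * B p))).
  - unfold m, s; field; lra.
  - rewrite L, H; ring.
Qed.

Lemma conformal_pencil (p u v : C) :
  inner pencil_metric p (Ci * u)%C (Ci * v)%C = inner pencil_metric p u v.
Proof. unfold pencil_metric; rewrite !inner_conformal; simpl; ring. Qed.

End PencilMetric.

Module CoefficientLists.
Import all_boot all_order all_algebra complex Rstruct ring zify.
Import RationalPencils.
Set Implicit Arguments. Unset Strict Implicit. Unset Printing Implicit Defensive.
Import Order.TTheory GRing.Theory Num.Theory.
Local Open Scope ring_scope.

(** * Transfer to pairs of real numbers *)

Local Notation K := (complex Rdefinitions.R).

Definition toC (x : K) : C := (complex.Re x, complex.Im x).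
Definition ofC (z : C) : K := Complex z.1 z.2.

Lemma toCK : cancel toC ofC. Proof. by case. Qed.
Lemma ofCK : cancel ofC toC. Proof. by case. Qed.

Lemma toCD x y : toC (x + y) = Cplus (toC x) (toC y).
Proof. by case: x; case: y. Qed.
Lemma toCN x : toC (- x) = Copp (toC x).
Proof. by case: x. Qed.
Lemma toCB x y : toC (x - y) = Cminus (toC x) (toC y).
Proof. by rewrite toCD toCN. Qed.
Lemma toCM x y : toC (x * y) = Cmult (toC x) (toC y).
Proof. by case: x; case: y. Qed.
Lemma toCX x n : toC (x ^+ n) = Cpow (toC x) n.
Proof. by elim: n => [|n IH] //; rewrite exprS toCM IH. Qed.
Lemma toC_neq0 x : x != 0 <-> toC x <> RtoC 0.
Proof.
split=> [/eqP x0 e|H]; first by apply: x0; rewrite -[x]toCK e.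
by apply/eqP => x0; apply: H; rewrite x0.
Qed.
Lemma toCV x : x != 0 -> toC (x^-1) = Cinv (toC x).
Proof.
move=> x0; have x0' := iffLR (toC_neq0 x) x0.
have e : Cmult (toC x^-1) (toC x) = RtoC 1 by rewrite -toCM mulVf.
by rewrite -[LHS]Cmult_1_r -(Cinv_r _ x0') Cmult_assoc e Cmult_1_l.
Qed.

Definition coefs (P : {poly K}) : list C := [seq toC a | a <- P].

Lemma peval_map (s : seq K) x : peval [seq toC a | a <- s] (toC x) = toC (Poly s).[x].
Proof.
elim: s => [|a s IH]; first by rewrite horner0.
by rewrite /= IH cons_poly_def hornerD hornerM hornerX hornerC addrC mulrC toCD toCM.
Qed.

Lemma peval_coefs P x : peval (coefs P) (toC x) = toC P.[x].
Proof. by rewrite peval_map polyseqK. Qed.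

Lemma peval_pderive_coefs P x : peval (pderive (coefs P)) (toC x) = toC P^`().[x].
Proof.
rewrite /coefs -[X in X^`()]polyseqK; elim: (polyseq P) => [|a s IH].
  by rewrite deriv0 horner0.
rewrite [map _ _]/= peval_pderive_cons IH peval_map /= cons_poly_def.
by rewrite derivD derivC addr0 derivM derivX mulr1 hornerD hornerM hornerX addrC mulrC toCD toCM.
Qed.

(** Equal values lie in one block, and no block is longer than l. *)
Lemma flatten_nseq_apart (T : eqType) (s : seq (T * nat)) l x0 i :
  uniq [seq x.1 | x <- s] -> all (fun x => x.2 <= l)%N s ->
  let B := flatten [seq nseq x.2 x.1 | x <- s] in
  (i + l < size B)%N -> nth x0 B i != nth x0 B (i + l).
Proof.
elim: s i => [//|[y e] s IH] i /= /andP[ys us] /andP[el als].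
rewrite size_cat size_nseq !nth_cat size_nseq => il.
case: (ltnP i e) => ie; last first.
  rewrite ifN -?leqNgt; last by lia.
  by rewrite -addnBAC // IH //; lia.
rewrite nth_nseq ie ifN -?leqNgt; last by lia.
set B := flatten _ in il *.
have : nth x0 B (i + l - e) \in B by apply: mem_nth; lia.
case/flattenP => t /mapP[[z f] zs ->] /nseqP[-> _].
by apply: contra ys => /eqP ->; apply: (map_f (fst : T * nat -> T) zs).
Qed.

Lemma prod_flatten_nseq (T : Type) (s : seq (T * nat)) (F : T -> K) :
  \prod_(y <- flatten [seq nseq x.2 x.1 | x <- s]) F y = \prod_(x <- s) F x.1 ^+ x.2.
Proof.
rewrite big_flatten big_map; apply: eq_bigr => x _.
by rewrite big_nseq -Monoid.iteropE.
Qed.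

Definition local_factorK (k : chart) (q : option K) (z : K) : K :=
  match k, q with
  | Zchart, Some x => z - x
  | Zchart, None => 1
  | Wchart, Some x => x * z - 1
  | Wchart, None => z
  end.

Lemma local_factorE k q z :
  toC (local_factorK k (omap ofC q) z) = local_factor k q (toC z).
Proof.
by case: k q => -[x|] //=; rewrite toCB ?toCM -/(toC (ofC x)) ofCK.
Qed.

Lemma divisor_polyE k (p : list sphere) m z :
  toC (\prod_(x <- zip [seq omap ofC q | q <- p] m) local_factorK k x.1 z ^+ x.2)
  = divisor_poly k p m (toC z).
Proof.
elim: p m => [|q p IH] [|e m]; rewrite ?big_nil //=.
by rewrite big_cons toCM toCX IH local_factorE.
Qed.

(** A point repeated m times occupies m consecutive slots; slots at distance l
    carry different points because no multiplicity exceeds l. *)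
Theorem exists_pencil_lists (l : nat) (p : list sphere) (m : list nat) :
  list_sum m = (2 * l)%N -> List.Forall (fun e => (e <= l)%coq_nat) m ->
  List.length p = List.length m -> List.NoDup p ->
  exists (P Q W P' Q' W' : list C) (c c' : C),
  (c <> RtoC 0 /\ c' <> RtoC 0) /\
  (forall z, Cminus (Cmult (peval P z) (peval (pderive Q) z))
                    (Cmult (peval (pderive P) z) (peval Q z)) = peval W z) /\
  (forall z, Cminus (Cmult (peval P' z) (peval (pderive Q') z))
                    (Cmult (peval (pderive P') z) (peval Q' z)) = peval W' z) /\
  (forall z : C, ~ (peval P z = RtoC 0 /\ peval Q z = RtoC 0)) /\
  (forall z : C, ~ (peval P' z = RtoC 0 /\ peval Q' z = RtoC 0)) /\
  (forall w : C, w <> RtoC 0 -> peval P' w = Cmult (Cpow w l.+1) (peval P (Cinv w)) /\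
                        peval Q' w = Cmult (Cpow w l.+1) (peval Q (Cinv w))) /\
  (forall w : C, w <> RtoC 0 -> peval W' w =
                        Copp (Cmult (Cpow w (2 * l)) (peval W (Cinv w)))) /\
  (forall z, peval W z = Cmult c (divisor_poly Zchart p m z)) /\
  (forall z, peval W' z = Cmult c' (divisor_poly Wchart p m z)).
Proof.
move=> sum_m le_m len nodup.
pose s := zip [seq omap ofC q | q <- p] m.
pose B := flatten [seq nseq x.2 x.1 | x <- s].
have len' : size [seq omap ofC q | q <- p] = size m by rewrite size_map.
have sizeB : size B = (l + l)%N.
  rewrite /B size_flatten /shape -map_comp.
  rewrite (eq_map (g := snd)); last by move=> x /=; rewrite size_nseq.
  rewrite -/(unzip2 s) unzip2_zip ?len' // addnn -mul2n -sum_m.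
  by elim: (m) => [//|e m' IH] /=; rewrite IH.
have uniq_s : uniq [seq x.1 | x <- s].
  rewrite -/(unzip1 s) unzip1_zip ?len' // map_inj_uniq.
    elim: nodup => [//|q p' nq _ IH] /=; rewrite IH andbT.
    apply/negP => qp; apply: nq; elim: (p') qp => [//|q' p'' IHq].
    by rewrite inE => /orP[/eqP->|/IHq]; [left|right].
  by apply: inj_omap; apply: (can_inj ofCK).
have all_s : all (fun x : option K * nat => x.2 <= l)%N s.
  apply/allP => x /(map_f snd); rewrite -/(unzip2 s) unzip2_zip ?len' //.
  move: x.2 => e; elim: le_m => [//|e' m' le' _ IH].
  by rewrite inE => /orP[/eqP->|/IH //]; apply/ssrnat.leP.
pose q (i : 'I_(l + l)) := nth None B i.
have q_apart i : q (lshift l i) != q (rshift l i).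
  rewrite /q /= addnC; apply: (flatten_nseq_apart None uniq_s all_s).
  by rewrite -/B sizeB ltn_add2r.
have prodq k z : toC (\prod_i local_factorK k (q i) z) = divisor_poly k p m (toC z).
  rewrite -divisor_polyE -/s.
  rewrite -(prod_flatten_nseq s (fun y => local_factorK k y z)) -/B.
  by rewrite (big_nth None) big_mkord sizeB.
have [P [Q [P' [Q' [c [c' [rev revW [nc nc'] [c0 WE] [c'0 WE']]]]]]]] :=
  exists_sphere_pencil q_apart.
exists (coefs P), (coefs Q), (coefs (wronskian P Q)).
exists (coefs P'), (coefs Q'), (coefs (wronskian P' Q')), (toC c), (toC c').
have onC (T : C -> Prop) : (forall x, T (toC x)) -> forall z, T z.
  by move=> H z; rewrite -[z]ofCK.
have wr (S T : {poly K}) (z : C) :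
    Cminus (Cmult (peval (coefs S) z) (peval (pderive (coefs T)) z))
           (Cmult (peval (pderive (coefs S)) z) (peval (coefs T) z))
    = peval (coefs (wronskian S T)) z.
  move: z; apply: onC => x; rewrite !peval_pderive_coefs !peval_coefs.
  by rewrite -!toCM -toCB /wronskian hornerD hornerN !hornerM.
have ncC (S T : {poly K}) : (forall x, ~~ (root S x && root T x)) ->
    forall z : C, ~ (peval (coefs S) z = RtoC 0 /\ peval (coefs T) z = RtoC 0).
  move=> H; apply: onC => x; rewrite !peval_coefs => -[e1 e2].
  have := H x; rewrite /root -[S.[x]]toCK -[T.[x]]toCK e1 e2.
  by rewrite (_ : ofC (RtoC 0) = 0) // eqxx.
split; first by split; apply/toC_neq0.
split; first exact: wr.
split; first exact: wr.
split; first exact: ncC.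
split; first exact: ncC.
split.
  apply: onC => w /toC_neq0 w0; rewrite -(toCV w0) -toCX !peval_coefs -!toCM.
  by have [-> ->] := rev w w0.
split.
  apply: onC => w /toC_neq0 w0; rewrite -(toCV w0) -toCX !peval_coefs -toCM -toCN.
  by rewrite revW // mul2n addnn.
split; apply: onC => x; rewrite peval_coefs -prodq -toCM.
  rewrite WE hornerZ horner_prod; congr (toC (_ * _)); apply: eq_bigr => i _.
  by case: (q i) => [y|] /=; rewrite !hornerE.
rewrite WE' hornerZ horner_prod; congr (toC (_ * _)); apply: eq_bigr => i _.
by case: (q i) => [y|] /=; rewrite !hornerE.
Qed.

End CoefficientLists.

(** * Zeros of the divisor polynomial *)

Definition entire (h : C -> C) : Prop := holomorphic_on everywhere h.

Lemma entire_ext f g : (forall z, f z = g z) -> entire f -> entire g.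
Proof. intros e H; now rewrite <- (functional_extensionality _ _ e). Qed.

Lemma entire_const c : entire (fun _ => c).
Proof. intros z _; apply ex_derive_const. Qed.

(** A derivative depends on the target space only through its norm, which is the
    same in the two normed module structures of the complex line. *)
Lemma is_derive_C (f : C -> C) (z f' : C) :
  is_derive (K := C_AbsRing) (V := AbsRing_NormedModule C_AbsRing) f z f' <->
  is_derive (K := C_AbsRing) (V := C_NormedModule) f z f'.
Proof.
  split; intros [[H1 H2 H3] H]; (split; [split; [exact H1 | exact H2 | exact H3] | exact H]).
Qed.

Lemma entire_id : entire (fun z => z).
Proof. intros z _; eexists; apply is_derive_C, (is_derive_id (K := C_AbsRing)). Qed.

Lemma entire_plus f g : entire f -> entire g -> entire (fun z => f z + g z)%C.
Proof.
  intros Hf Hg z _.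
  apply (ex_derive_plus (K := C_AbsRing) (V := C_NormedModule) f g z (Hf z I) (Hg z I)).
Qed.

Lemma entire_mult f g : entire f -> entire g -> entire (fun z => f z * g z)%C.
Proof.
  intros Hf Hg z _; destruct (Hf z I) as [f' Df], (Hg z I) as [g' Dg].
  eexists; apply is_derive_C.
  apply (is_derive_mult (K := C_AbsRing) f g z f' g');
    [now apply is_derive_C | now apply is_derive_C | apply Cmult_comm].
Qed.

Lemma entire_pow f n : entire f -> entire (fun z => f z ^ n)%C.
Proof.
  intros Hf; induction n as [|n IH]; [apply (entire_const 1) |].
  apply (entire_mult f); assumption.
Qed.

Lemma entire_local_factor k q : entire (local_factor k q).
Proof.
  destruct k, q as [x|].
  - apply (entire_plus (fun z => z) (fun _ => - x)%C); [apply entire_id | apply entire_const].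
  - apply (entire_const 1).
  - apply (entire_plus (fun z => x * z)%C (fun _ => - RtoC 1)%C); [| apply entire_const].
    apply (entire_mult (fun _ => x)); [apply entire_const | apply entire_id].
  - apply entire_id.
Qed.

Lemma entire_divisor_poly k p m : entire (divisor_poly k p m).
Proof.
  revert m; induction p as [|q p IH]; intros [|e m]; try apply (entire_const 1).
  apply (entire_mult (fun z => local_factor k q z ^ e)%C); [| apply IH].
  apply entire_pow, entire_local_factor.
Qed.

Lemma local_factor_at q z : local_factor (chart_at q) q z = (z - coord_at q)%C.
Proof. destruct q; simpl; ring. Qed.

Lemma local_factor_eq0 q q' : local_factor (chart_at q) q' (coord_at q) = 0%C <-> q = q'.
Proof.
  split.
  - destruct q as [z|], q' as [x|]; simpl; intros H; trivial.
    + f_equal; replace z with (z - x + x)%C by ring; rewrite H; ring.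
    + apply (f_equal fst) in H; simpl in H; lra.
    + replace (x * 0 - 1)%C with (- (1))%C in H by ring.
      apply (f_equal fst) in H; simpl in H; lra.
  - intros <-; rewrite local_factor_at; ring.
Qed.

Lemma divisor_poly_eq0 k p m z : length p = length m -> Forall (fun e => (1 <= e)%nat) m ->
  divisor_poly k p m z = 0%C <-> exists q, In q p /\ local_factor k q z = 0%C.
Proof.
  revert m; induction p as [|q p IH]; intros [|e m] len pos; try discriminate.
  - split; [intros H | intros (q & [] & _)].
    apply (f_equal fst) in H; simpl in H; lra.
  - inversion pos as [|? ? He pos']; subst; injection len as len; simpl.
    destruct (Ceq_dec (local_factor k q z) 0) as [e0|n0].
    + rewrite e0; split; [eauto | intros _].
      destruct e as [|e]; [lia | rewrite Cpow_S; ring].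
    + destruct (Ceq_dec (divisor_poly k p m z) 0) as [d0|nd].
      * rewrite d0; split; [intros _ | intros _; ring].
        destruct (proj1 (IH m len pos') d0) as (q' & H1 & H2); eauto.
      * split.
        -- intros H; exfalso; revert H; apply Cmult_neq_0; [apply Cpow_nz |]; assumption.
        -- intros (q' & [<-|H1] & H2); [contradiction |].
           elim nd; apply IH; eauto.
Qed.

Lemma divisor_poly_factor p m q e : length p = length m -> NoDup p ->
  In (q, e) (combine p m) ->
  exists h, entire h /\ h (coord_at q) <> 0%C /\
    forall z, divisor_poly (chart_at q) p m z = ((z - coord_at q) ^ e * h z)%C.
Proof.
  revert m; induction p as [|q' p IH]; intros [|e' m] len nodup H; try contradiction; try discriminate.
  inversion nodup as [|? ? nq nodup']; subst; injection len as len; simpl in H.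
  destruct H as [H|H].
  - injection H as -> ->; exists (divisor_poly (chart_at q) p m).
    split; [apply entire_divisor_poly |]; split.
    + clear - nq len; revert m len; induction p as [|q' p IH]; intros [|e m] len; try discriminate.
      * intros H; apply (f_equal fst) in H; simpl in H; lra.
      * simpl; apply Cmult_neq_0.
        -- apply Cpow_nz; intros H; apply local_factor_eq0 in H; subst; apply nq; now left.
        -- apply IH; [intros H; apply nq; now right | now injection len].
    + intros z; simpl; now rewrite local_factor_at.
  - destruct (IH m len nodup' H) as (h & Hh & h0 & Eh).
    exists (fun z => local_factor (chart_at q) q' z ^ e' * h z)%C; split; [| split].
    + apply (entire_mult (fun z => local_factor (chart_at q) q' z ^ e')%C); [| exact Hh].
      apply entire_pow, entire_local_factor.
    + apply Cmult_neq_0; [apply Cpow_nz | exact h0].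
      intros H0; apply local_factor_eq0 in H0; subst.
      apply nq; eapply in_combine_l; eassumption.
    + intros z; simpl; rewrite Eh; ring.
Qed.

Lemma Forall2_combine {A B} (R : A -> B -> Prop) (p : list A) (m : list B) :
  length p = length m -> (forall a b, In (a, b) (combine p m) -> R a b) -> Forall2 R p m.
Proof.
  revert m; induction p as [|a p IH]; intros [|b m] len H; try discriminate; constructor.
  - apply H; now left.
  - apply IH; [now injection len | intros; apply H; now right].
Qed.

(** * The metric on the sphere *)

Lemma Rpower_pow_mult n x s : 0 < x -> Rpower (x ^ n) s = Rpower x (INR n * s).
Proof. intros H; rewrite <- Rpower_pow by exact H; apply Rpower_mult. Qed.

Section SphereMetric.
Variables (l : nat) (P Q W P' Q' W' : list C).
Hypothesis ncz : forall z : C, ~ (peval P z = 0%C /\ peval Q z = 0%C).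
Hypothesis ncz' : forall z : C, ~ (peval P' z = 0%C /\ peval Q' z = 0%C).
Hypothesis wr : forall z,
  (peval P z * peval (pderive Q) z - peval (pderive P) z * peval Q z)%C = peval W z.
Hypothesis wr' : forall z,
  (peval P' z * peval (pderive Q') z - peval (pderive P') z * peval Q' z)%C = peval W' z.
Hypothesis rev : forall w : C, w <> 0%C ->
  peval P' w = (w ^ S l * peval P (/ w))%C /\ peval Q' w = (w ^ S l * peval Q (/ w))%C.
Hypothesis revW : forall w : C, w <> 0%C ->
  peval W' w = (- (w ^ (2 * l) * peval W (/ w)))%C.

Let d := INR (S l).
Let d_pos : 0 < d.
Proof. apply lt_0_INR; lia. Qed.

Lemma pencil_norm_rev (w : C) : w <> 0%C ->
  pencil_norm P' Q' w = norm2 w ^ S l * pencil_norm P Q (/ w)%C.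
Proof.
  intros w0; unfold pencil_norm, sq_poly; destruct (rev w w0) as [-> ->].
  rewrite !norm2_mult, !norm2_pow; ring.
Qed.

Definition sphere_tensor (k : chart) : tensor :=
  match k with Zchart => pencil_metric l P Q | Wchart => pencil_metric l P' Q' end.

Lemma sphere_tensor_riemannian k : riemannian (sphere_tensor k).
Proof. destruct k; apply pencil_metric_riemannian; assumption. Qed.

Lemma Rpower_rev (w : C) s : w <> 0%C -> Rpower (pencil_norm P' Q' w) s =
  Rpower (norm2 w) (d * s) * Rpower (pencil_norm P Q (/ w)%C) s.
Proof.
  intros w0; assert (N := norm2_pos w w0).
  rewrite pencil_norm_rev by exact w0.
  rewrite <- Rpower_mult_distr, Rpower_pow_mult; trivial.
  - now apply pow_lt.
  - now apply pencil_norm_pos.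
Qed.

Lemma sphere_tensor_compat (w u v : C) : w <> 0%C ->
  inner (sphere_tensor Wchart) w u v =
  inner (sphere_tensor Zchart) (/ w)%C (- / (w * w) * u)%C (- / (w * w) * v)%C.
Proof.
  intros w0; assert (N := norm2_pos w w0); simpl.
  unfold pencil_metric; rewrite !inner_conformal.
  unfold pencil_factor; fold d; rewrite Rpower_rev by exact w0.
  replace (d * (-2 / d)) with (- (1) + - (1)) by (field; lra).
  rewrite Rpower_plus, Rpower_Ropp, Rpower_1 by exact N.
  set (a := (- / (w * w))%C).
  assert (Na : norm2 a = / norm2 w * / norm2 w).
  { replace (norm2 a) with (norm2 (/ (w * w))%C) by (unfold a, norm2; simpl; ring).
    rewrite norm2_inv by (apply Cmult_neq_0; assumption).
    rewrite norm2_mult; field; lra. }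
  rewrite <- Na; unfold norm2; simpl; ring.
Qed.

Definition pencil_sphere_metric : sphere_metric :=
  {| metric_in := sphere_tensor;
     metric_riemannian := sphere_tensor_riemannian;
     metric_compat := sphere_tensor_compat |}.

Definition chart_curvature (k : chart) : C -> R :=
  match k with Zchart => pencil_curvature l P Q W | Wchart => pencil_curvature l P' Q' W' end.

Lemma chart_curvature_rev (w : C) : w <> 0%C ->
  chart_curvature Wchart w = chart_curvature Zchart (/ w)%C.
Proof.
  intros w0; assert (N := norm2_pos w w0); simpl; unfold pencil_curvature; fold d.
  rewrite Rpower_rev by exact w0.
  unfold sq_poly; rewrite revW by exact w0.
  replace (norm2 (- (w ^ (2 * l) * peval W (/ w)))%C)
    with (norm2 (w ^ (2 * l) * peval W (/ w))%C) by (unfold norm2; simpl; ring).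
  rewrite norm2_mult, norm2_pow.
  replace (d * (2 / d - 2)) with (- INR (2 * l)).
  - rewrite Rpower_Ropp, Rpower_pow by exact N.
    field; split; [lra | apply pow_nonzero; lra].
  - assert (dl : d = INR l + 1) by apply S_INR.
    rewrite mult_INR; replace (INR l) with (d - 1) by lra; simpl; field; lra.
Qed.

(** [curvature] reads the coordinate w at infinity only; elsewhere in that chart
    the explicit formulas in z and w have to be compared. *)
Lemma curvature_chart_point k z :
  curvature pencil_sphere_metric (chart_point k z) = chart_curvature k z.
Proof.
  assert (HZ : forall z, curvature pencil_sphere_metric (Some z) = chart_curvature Zchart z).
  { intros z'; unfold curvature; simpl.
    now rewrite (gauss_curvature_pencil l P Q W ncz wr). }
  destruct k; simpl chart_point; [apply HZ |].
  destruct (Ceq_dec z 0) as [->|z0].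
  - unfold curvature; simpl.
    now rewrite (gauss_curvature_pencil l P' Q' W' ncz' wr').
  - rewrite HZ; symmetry; now apply chart_curvature_rev.
Qed.

Lemma pencil_sphere_conformal : conformal pencil_sphere_metric.
Proof. intros [] p u v; apply conformal_pencil. Qed.

Lemma pencil_sphere_ricci : generalized_ricci (- 2 * INR l) 0 0 pencil_sphere_metric.
Proof. intros [] p; eapply pencil_ricci; eassumption. Qed.

Lemma curvature_at q :
  curvature pencil_sphere_metric q = chart_curvature (chart_at q) (coord_at q).
Proof.
  rewrite <- curvature_chart_point; f_equal.
  destruct q; simpl; trivial; destruct (Ceq_dec 0 0); congruence.
Qed.

Definition chart_wronskian (k : chart) := match k with Zchart => W | Wchart => W' end.
Definition chart_norm (k : chart) :=
  match k with Zchart => pencil_norm P Q | Wchart => pencil_norm P' Q' end.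

Definition curvature_unit (k : chart) (z : C) : R :=
  sqrt (4 / d) * Rpower (chart_norm k z) (1 / d - 1).

Lemma curvature_unit_pos k z : 0 < curvature_unit k z.
Proof.
  apply Rmult_lt_0_compat; [apply sqrt_lt_R0 | apply exp_pos].
  apply Rdiv_lt_0_compat; lra.
Qed.

Lemma sqrt_chart_curvature k z :
  sqrt (chart_curvature k z) = curvature_unit k z * Cmod (peval (chart_wronskian k) z).
Proof.
  assert (D : 0 <= 4 / d) by (apply Rlt_le, Rdiv_lt_0_compat; lra).
  set (N := norm2 (peval (chart_wronskian k) z)).
  assert (HN : 0 <= N) by apply norm2_ge0.
  replace (chart_curvature k z) with
    (4 / d * (Rpower (chart_norm k z) (1 / d - 1) * Rpower (chart_norm k z) (1 / d - 1)) * N).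
  - rewrite Cmod_norm2; fold N; unfold curvature_unit.
    set (r := Rpower (chart_norm k z) (1 / d - 1)).
    assert (r_pos : 0 < r) by apply exp_pos.
    assert (rr : 0 <= r * r) by nra.
    rewrite (sqrt_mult (4 / d * (r * r)) N), (sqrt_mult (4 / d) (r * r)), (sqrt_square r);
      trivial; try lra.
    now apply Rmult_le_pos.
  - rewrite <- Rpower_plus.
    replace (1 / d - 1 + (1 / d - 1)) with (2 / d - 2) by (field; lra).
    unfold N; destruct k; unfold chart_norm, chart_wronskian, chart_curvature,
      pencil_curvature, sq_poly; fold d; ring.
Qed.

Lemma curvature_ge0 q : 0 <= curvature pencil_sphere_metric q.
Proof.
  assert (H : 0 < 4 / d) by (apply Rdiv_lt_0_compat; lra).
  rewrite curvature_at; destruct (chart_at q); simpl; unfold pencil_curvature; fold d;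
    (apply Rmult_le_pos; [lra |]; apply Rmult_le_pos;
     [apply norm2_ge0 | apply Rlt_le, exp_pos]).
Qed.

Lemma smooth_curvature_unit k n : Ck n (curvature_unit k).
Proof.
  apply Ck_mult; [apply Ck_const |].
  destruct k; (apply Ck_Rpower;
    [intros; now apply pencil_norm_pos | apply Ck_plus; apply Ck_sq_poly]).
Qed.

Variables (p : list sphere) (m : list nat) (c : chart -> C).
Hypothesis c_neq0 : forall k, c k <> 0%C.
Hypothesis len : length p = length m.
Hypothesis m_pos : Forall (fun e => (1 <= e)%nat) m.
Hypothesis nodup : NoDup p.
Hypothesis divisorE : forall k z,
  peval (chart_wronskian k) z = (c k * divisor_poly k p m z)%C.

Lemma sqrt_curvature_eq0 q : sqrt (curvature pencil_sphere_metric q) = 0 <-> In q p.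
Proof.
  rewrite curvature_at, sqrt_chart_curvature.
  assert (u := curvature_unit_pos (chart_at q) (coord_at q)).
  transitivity (divisor_poly (chart_at q) p m (coord_at q) = 0%C).
  - rewrite divisorE, Cmod_mult; split; intros H.
    + assert (c0 := proj1 (Cmod_gt_0 _) (c_neq0 (chart_at q))).
      apply Cmod_eq_0; apply Rmult_integral in H as [H|H]; [lra |].
      apply Rmult_integral in H as [H|H]; [lra | exact H].
    + rewrite H, Cmod_0; ring.
  - rewrite divisor_poly_eq0 by assumption; split.
    + intros (q' & H1 & H2); apply local_factor_eq0 in H2; now subst.
    + intros H; exists q; split; [exact H | now apply local_factor_eq0].
Qed.

Lemma zero_orders :
  Forall2 (zero_order (fun q => sqrt (curvature pencil_sphere_metric q))) p m.
Proof.
  apply Forall2_combine; [exact len |]; intros q e qe.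
  set (k := chart_at q).
  destruct (divisor_poly_factor p m q e len nodup qe) as (h & Hh & h0 & Eh).
  exists everywhere, (fun z => RtoC (curvature_unit k z)), (peval (chart_wronskian k)).
  split; [apply open_true |]. split; [exact I |].
  split; [intros n; apply smooth_curvature_unit |].
  split; [intros n; apply (Ck_const n 0) |].
  split.
  { intros z _ H; apply RtoC_inj in H; assert (u := curvature_unit_pos k z); lra. }
  split.
  { apply (entire_ext (fun z => c k * divisor_poly k p m z)%C).
    - intros z; now rewrite divisorE.
    - apply (entire_mult (fun _ => c k)); [apply entire_const | apply entire_divisor_poly]. }
  split.
  { exists (fun z => c k * h z)%C; split; [| split].
    - apply (entire_mult (fun _ => c k)); [apply entire_const | exact Hh].
    - apply Cmult_neq_0; [apply c_neq0 | exact h0].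
    - intros z _; rewrite divisorE; unfold k; rewrite Eh; ring. }
  intros z _; rewrite curvature_chart_point, sqrt_chart_curvature, Cmod_mult, Cmod_R.
  rewrite Rabs_pos_eq; [reflexivity | apply Rlt_le, curvature_unit_pos].
Qed.

End SphereMetric.

Theorem theorem5p5 (l : nat) (m : list nat) (p : list sphere)
  (hl : (1 <= l)%nat)
  (hm : is_partition (2 * l) m)
  (hml : Forall (fun k => (k <= l)%nat) m)
  (hlen : length p = length m)
  (hp : NoDup p) :
  exists g : sphere_metric,
    conformal g /\
    generalized_ricci (- 2 * INR l) 0 0 g /\
    (forall q, 0 <= curvature g q) /\
    (forall q, sqrt (curvature g q) = 0 <-> In q p) /\
    Forall2 (zero_order (fun q => sqrt (curvature g q))) p m.
Proof.
  destruct hm as (_ & m_pos & m_sum).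
  destruct (@CoefficientLists.exists_pencil_lists l p m m_sum hml hlen hp)
    as (P & Q & W & P' & Q' & W' & c & c' & [c0 c0'] & wr & wr' & nc & nc' & rev & revW & E & E').
  set (cc k := match k with Zchart => c | Wchart => c' end).
  assert (cc0 : forall k, cc k <> 0%C) by (intros []; assumption).
  assert (EE : forall k z, peval (chart_wronskian W W' k) z = (cc k * divisor_poly k p m z)%C)
    by (intros []; assumption).
  exists (pencil_sphere_metric l P Q P' Q' nc nc' rev).
  split; [apply pencil_sphere_conformal |].
  split; [now apply (pencil_sphere_ricci l P Q W P' Q' W') |].
  split; [now apply (curvature_ge0 l P Q W P' Q' W') |].
  split; [intros q; now apply (sqrt_curvature_eq0 l P Q W P' Q' W') with (m := m) (c := cc) |].
  now apply (zero_orders l P Q W P' Q' W') with (c := cc).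
Qed.
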